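(* Let $n\ge 1$ and let $\mathscr{Z}_n=\{(A,B)\in M_n(\mathbb{C})\times M_n(\mathbb{C}) : AB+BA=0\}$. Let $\mathcal{TP}_n=\{(p,m,r)\in\mathbb{Z}_{\ge 0}^3 : 2p+m+r=n\}$. Then the irreducible components of $\mathscr{Z}_n$ are exactly the subvarieties $\mathscr{Z}_{p,m,r}$, $(p,m,r)\in\mathcal{TP}_n$, one for each triple (distinct triples give distinct components), so that $\mathscr{Z}_n=\bigcup_{(p,m,r)\in\mathcal{TP}_n}\mathscr{Z}_{p,m,r}$. Moreover $\dim\mathscr{Z}_{p,m,r}=n^2+p$.
   Context: $G=GL_n(\mathbb{C})$ acts on pairs of matrices by simultaneous conjugation $g\cdot(A,B)=(gAg^{-1},gBg^{-1})$. For $(p,m,r)\in\mathcal{TP}_n$, let $\mathscr{Z}^\circ_{p,m,r}$ be the union of the $G$-orbits of all pairs $(A,B)\in\mathscr{Z}_n$ with $A=\mathrm{diag}(a_1,-a_1,a_2,-a_2,\dots,a_p,-a_p,a_{p+1},\dots,a_{p+m},0,\dots,0)$ ($r$ zeros at the end), where $a_i\in\mathbb{C}^*$ and $a_i\neq\pm a_j$ for all $1\le i\neq j\le p+m$. The variety $\mathscr{Z}_{p,m,r}$ is the Zariski closure of $\mathscr{Z}^\circ_{p,m,r}$ in $\mathscr{Z}_n$. *)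

(* Defs.v *)
(* C := R[i] for an arbitrary R : realType (a complete
   archimedean ordered field, i.e. the real numbers up to isomorphism), so
   R[i] is the field of complex numbers up to isomorphism. *)
From mathcomp Require Import all_boot all_order all_algebra.
From mathcomp Require Import reals complex.
Set Implicit Arguments. Unset Strict Implicit. Unset Printing Implicit Defensive.
Import GRing.Theory Num.Theory.
Local Open Scope ring_scope.

Definition mxpair (C : fieldType) (n : nat) := ('M[C]_n * 'M[C]_n)%type.
Definition pset (C : fieldType) (n : nat) := mxpair C n -> Prop.

Definition psubset C n (X Y : pset C n) := forall x, X x -> Y x.
Definition pseteq C n (X Y : pset C n) := forall x, X x <-> Y x.

Inductive polyfun (C : fieldType) (n : nat) : (mxpair C n -> C) -> Prop :=
| pf_const (c : C) : polyfun (fun _ => c)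
| pf_coord1 (i j : 'I_n) : polyfun (fun x => x.1 i j)
| pf_coord2 (i j : 'I_n) : polyfun (fun x => x.2 i j)
| pf_add f g : polyfun f -> polyfun g -> polyfun (fun x => f x + g x)
| pf_mul f g : polyfun f -> polyfun g -> polyfun (fun x => f x * g x).

Definition zclosed C n (Z : pset C n) : Prop :=
  exists F : (mxpair C n -> C) -> Prop,
    (forall f, F f -> polyfun f) /\
    (forall x, Z x <-> (forall f, F f -> f x = 0)).

Definition zclosure C n (S : pset C n) : pset C n :=
  fun x => forall Z, zclosed Z -> psubset S Z -> Z x.

Definition zirreducible C n (Z : pset C n) : Prop :=
  [/\ zclosed Z, (exists x, Z x) &
      forall Z1 Z2, zclosed Z1 -> zclosed Z2 ->
        (forall x, Z x -> Z1 x \/ Z2 x) -> psubset Z Z1 \/ psubset Z Z2].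

Definition irr_component C n (X Z : pset C n) : Prop :=
  [/\ zirreducible Z, psubset Z X &
      forall Z', zirreducible Z' -> psubset Z Z' -> psubset Z' X -> psubset Z' Z].

Definition irr_chain C n (X : pset C n) (d : nat) (c : nat -> pset C n) : Prop :=
  [/\ forall k, (k <= d)%N -> zirreducible (c k),
      forall k, (k < d)%N -> psubset (c k) (c k.+1) /\ ~ psubset (c k.+1) (c k) &
      psubset (c d) X].

Definition zdim C n (X : pset C n) (d : nat) : Prop :=
  (exists c, irr_chain X d c) /\ ~ (exists c, irr_chain X d.+1 c).

Definition Zn C n : pset C n := fun x => x.1 *m x.2 + x.2 *m x.1 = 0.

(* Diagonal entries (0-indexed) of
   diag(a_1,-a_1,...,a_p,-a_p,a_{p+1},...,a_{p+m},0,...,0),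
   where a is 0-indexed: a_k (1-indexed) = a (k-1). *)
Definition tp_diag (C : fieldType) (p m : nat) (a : nat -> C) (i : nat) : C :=
  if (i < 2 * p)%N then (if odd i then - a i./2 else a i./2)
  else if (i < 2 * p + m)%N then a (i - p)%N else 0.

Definition good_params (C : fieldType) (p m : nat) (a : nat -> C) : Prop :=
  (forall i, (i < p + m)%N -> a i != 0) /\
  (forall i j, (i < p + m)%N -> (j < p + m)%N -> i != j ->
     a i != a j /\ a i != - a j).

Definition Zcirc C n (p m r : nat) : pset C n :=
  fun x => (2 * p + m + r)%N = n /\
    exists (g A0 B0 : 'M[C]_n) (a : nat -> C),
      [/\ g \in unitmx, good_params p m a,
          A0 = diag_mx (\row_(i < n) tp_diag p m a i),
          @Zn C n (A0, B0) &
          x = (g *m A0 *m invmx g, g *m B0 *m invmx g)].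

(* Z_{p,m,r}: Zariski closure of Z°_{p,m,r} (closure in Z_n = closure in the
   ambient space, since Z_n is closed). *)
Definition Zpmr C n (p m r : nat) : pset C n := zclosure (@Zcirc C n p m r).

Arguments Zn : clear implicits.
Arguments Zcirc : clear implicits.
Arguments Zpmr : clear implicits.

(* Main.v *)
Require Import Defs.
From mathcomp Require Import all_boot all_order all_algebra fingroup perm.
From mathcomp Require Import boolp reals complex ring zify.
Set Implicit Arguments. Unset Strict Implicit. Unset Printing Implicit Defensive.
Import GRing.Theory Num.Theory.
Local Open Scope ring_scope.

(* Each stratum is the image of the rational map
   (g, a, B) |-> (g A0(a) g^-1, g B g^-1) with B supported where A0 allows it, so its closure
   is irreducible. Fixing the part of g that commutes with A0 leaves n^2 + p parameters: counting
   monomials bounds every chain of irreducible closed sets by that number, and freeing the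
   parameters one at a time gives a chain of that length. The numbers m, r, p can only grow under
   containment of closures, because they bound the ranks of the Hankel matrices of
   tr A^(2s+1), tr B^(2s+1), and half the rank of A B; as 2p + m + r = n, no closure
   contains another.

   It remains to see that the pairs with A diagonalizable and nonzero eigenvalues simple are dense
   in Z_n. By induction on n this holds for pairs where A^2 or B^2 has two distinct eigenvalues,
   as these split. Otherwise, up to exchanging A and B, the minimal polynomial of B is even or odd,
   and a Krylov basis of B provides S anticommuting with B. If B is not cyclic then S is singular
   and not nilpotent, and A is moved towards S. If B is cyclic then S^2 = 1 and A = S q(B), and B is
   deformed inside the companion matrices anticommuting with S (A is again moved towards S
   when n = 2). *)

(** * Function algebras and the Zariski closure *)

(** Closures are always reached along polynomial curves in one parameter: an open condition that
    holds at one parameter holds at almost all of them, so every point of the curve is a limit of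
    good ones. The squares A^2 and B^2 are the right test matrices because they commute with both A
    and B, so their generalized eigenspaces split the pair, and because the test is symmetric in A
    and B, which diagonalizability of A is not. If B^2 has one eigenvalue, B has only the
    eigenvalues mu and - mu, and a Krylov vector has to avoid just two proper subspaces. The parity
    of the minimal polynomial P of B enters as P(- B) = 0: this closes the Horner scheme that builds
    S. It holds when A is invertible, since A conjugates B to - B. If A is singular and A^2 has one
    eigenvalue, A is nilpotent and satisfies the parity condition itself, hence the exchange. Size 2
    is exceptional: the deformation of B uses three Krylov vectors, and its substitute reaches
    diagonalizable A directly, where no exchange is possible. *)

Section FunctionAlgebra.
Variables (K : fieldType) (X : Type).
Implicit Types (f g : X -> K) (P : (X -> K) -> Prop).

(** Three algebras are instances: polynomial functions of a pair, polynomial functions of one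
    parameter, and functions of bounded degree in each coordinate. Determinants, adjugates and
    [horner_mx] are treated once for all of them. *)
Record falg P : Prop := Falg {
  falgC : forall c, P (fun=> c);
  falgD : forall f g, P f -> P g -> P (fun x => f x + g x);
  falgM : forall f g, P f -> P g -> P (fun x => f x * g x) }.

Definition mxfalg P m n (F : X -> 'M[K]_(m, n)) := forall i j, P (fun x => F x i j).

Variable P : (X -> K) -> Prop.
Hypothesis PA : falg P.

Lemma falg_ext f g : f =1 g -> P f -> P g.
Proof. by move=> /funext->. Qed.

Lemma falgN f : P f -> P (fun x => - f x).
Proof.
move=> Pf; apply: falg_ext (falgM PA (falgC PA (-1)) Pf) => x.
by rewrite mulN1r.
Qed.

Lemma falgB f g : P f -> P g -> P (fun x => f x - g x).
Proof. by move=> Pf Pg; apply: falgD => //; apply: falgN. Qed.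

Lemma falg_sum I (r : seq I) (Q : pred I) (F : I -> X -> K) :
  (forall i, Q i -> P (F i)) -> P (fun x => \sum_(i <- r | Q i) F i x).
Proof.
move=> PF; elim: r => [|i r IHr].
  by apply: falg_ext (falgC PA 0) => x; rewrite big_nil.
case Qi: (Q i); last by apply: falg_ext IHr => x; rewrite big_cons Qi.
by apply: falg_ext (falgD PA (PF i Qi) IHr) => x; rewrite big_cons Qi.
Qed.

Lemma falg_prod I (r : seq I) (Q : pred I) (F : I -> X -> K) :
  (forall i, Q i -> P (F i)) -> P (fun x => \prod_(i <- r | Q i) F i x).
Proof.
move=> PF; elim: r => [|i r IHr].
  by apply: falg_ext (falgC PA 1) => x; rewrite big_nil.
case Qi: (Q i); last by apply: falg_ext IHr => x; rewrite big_cons Qi.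
by apply: falg_ext (falgM PA (PF i Qi) IHr) => x; rewrite big_cons Qi.
Qed.

Lemma falgX f k : P f -> P (fun x => f x ^+ k).
Proof.
move=> Pf; elim: k => [|k IHk]; first exact: falgC.
by under [fun x => _]funext => x do rewrite exprS; apply: falgM.
Qed.

Lemma mxfalgC m n (A : 'M_(m, n)) : mxfalg P (fun=> A).
Proof. by move=> i j; apply: falgC. Qed.

Lemma mxfalgD m n (F G : X -> 'M_(m, n)) :
  mxfalg P F -> mxfalg P G -> mxfalg P (fun x => F x + G x).
Proof.
by move=> PF PG i j; apply: falg_ext (falgD PA (PF i j) (PG i j)) => x; rewrite mxE.
Qed.

Lemma mxfalgZ m n f (F : X -> 'M_(m, n)) :
  P f -> mxfalg P F -> mxfalg P (fun x => f x *: F x).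
Proof.
by move=> Pf PF i j; apply: falg_ext (falgM PA Pf (PF i j)) => x; rewrite mxE.
Qed.

Lemma mxfalgN m n (F : X -> 'M_(m, n)) : mxfalg P F -> mxfalg P (fun x => - F x).
Proof. by move=> PF i j; apply: falg_ext (falgN (PF i j)) => x; rewrite mxE. Qed.

Lemma mxfalgB m n (F G : X -> 'M_(m, n)) :
  mxfalg P F -> mxfalg P G -> mxfalg P (fun x => F x - G x).
Proof. by move=> PF PG; apply: mxfalgD => //; apply: mxfalgN. Qed.

Lemma mxfalgM m n p (F : X -> 'M_(m, n)) (G : X -> 'M_(n, p)) :
  mxfalg P F -> mxfalg P G -> mxfalg P (fun x => F x *m G x).
Proof.
move=> PF PG i j.
under [fun x => _]funext => x do rewrite mxE.
by apply: falg_sum => k _; apply: falgM.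
Qed.

Lemma mxfalgX n (F : X -> 'M_n.+1) k :
  mxfalg P F -> mxfalg P (fun x => F x ^+ k).
Proof.
move=> PF; elim: k => [|k IHk]; first exact: mxfalgC.
by under [fun x => _]funext => x do rewrite exprS; apply: mxfalgM.
Qed.

Lemma mxfalg_horner n (F : X -> 'M_n.+1) (p : {poly K}) :
  mxfalg P F -> mxfalg P (fun x => horner_mx (F x) p).
Proof.
move=> PF; elim/poly_ind: p => [|p c IHp].
  by under [fun x => _]funext => x do rewrite rmorph0; apply: mxfalgC.
under [fun x => _]funext => x do rewrite rmorphD rmorphM /= horner_mx_X horner_mx_C.
by apply: mxfalgD; [apply: mxfalgM | apply: mxfalgC].
Qed.

Lemma falg_det n (F : X -> 'M_n) : mxfalg P F -> P (fun x => \det (F x)).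
Proof.
move=> PF; apply: falg_sum => s _; apply: falgM => //; first exact: falgC.
by apply: falg_prod => i _; apply: PF.
Qed.

Lemma falg_tr n (F : X -> 'M_n) : mxfalg P F -> P (fun x => \tr (F x)).
Proof. by move=> PF; apply: falg_sum => i _; apply: PF. Qed.

Lemma mxfalg_adj n (F : X -> 'M_n) : mxfalg P F -> mxfalg P (fun x => \adj (F x)).
Proof.
move=> PF i j.
have Pc : P (fun x => cofactor (F x) j i).
  apply: falgM => //; first exact: falgC.
  apply: falg_det => k l; apply: falg_ext (PF (lift j k) (lift i l)) => x.
  by rewrite !mxE.
by apply: falg_ext Pc => x; rewrite mxE.
Qed.

Lemma mxfalg_diag n (F : X -> 'rV_n) : mxfalg P F -> mxfalg P (fun x => diag_mx (F x)).
Proof.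
move=> PF i j; case eij: (i == j).
  by apply: falg_ext (PF 0 j) => x; rewrite mxE eij (eqP eij).
by apply: falg_ext (falgC PA 0) => x; rewrite mxE eij.
Qed.

Lemma mxfalg_block m1 m2 n1 n2 (F : X -> 'M_(m1, n1)) (G : X -> 'M_(m1, n2))
    (H : X -> 'M_(m2, n1)) (L : X -> 'M_(m2, n2)) :
  mxfalg P F -> mxfalg P G -> mxfalg P H -> mxfalg P L ->
  mxfalg P (fun x => block_mx (F x) (G x) (H x) (L x)).
Proof.
move=> PF PG PH PL i j; case: (split_ordP i) => k ->; case: (split_ordP j) => l ->.
- by apply: falg_ext (PF k l) => x; rewrite block_mxEul.
- by apply: falg_ext (PG k l) => x; rewrite block_mxEur.
- by apply: falg_ext (PH k l) => x; rewrite block_mxEdl.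
- by apply: falg_ext (PL k l) => x; rewrite block_mxEdr.
Qed.

Lemma falg_polyfun n (F : X -> mxpair K n) :
  mxfalg P (fun x => (F x).1) -> mxfalg P (fun x => (F x).2) ->
  forall q, polyfun q -> P (fun x => q (F x)).
Proof.
move=> P1 P2 q; elim=> {q} [c|i j|i j|q1 q2 _ Pq1 _ Pq2|q1 q2 _ Pq1 _ Pq2].
- exact: falgC.
- exact: P1.
- exact: P2.
- exact: falgD.
- exact: falgM.
Qed.

(** Clearing denominators: conjugation by g divides by its determinant, and a power of [delta]
    brings the composite back into the algebra. *)
Lemma falg_polyfun_rat n (G : X -> mxpair K n) (delta : X -> K) q :
  P delta -> mxfalg P (fun x => (G x).1) -> mxfalg P (fun x => (G x).2) ->
  polyfun q ->
  exists2 F, P F & exists M, forall x, delta x != 0 ->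
    F x = delta x ^+ M * q ((delta x)^-1 *: (G x).1, (delta x)^-1 *: (G x).2).
Proof.
move=> Pd P1 P2; elim=> {q} [c|i j|i j|q1 q2 _ [F1 PF1 [M1 E1]] _ [F2 PF2 [M2 E2]]
                          |q1 q2 _ [F1 PF1 [M1 E1]] _ [F2 PF2 [M2 E2]]].
- by exists (fun=> c); [apply: falgC | exists 0 => x _; rewrite mul1r].
- exists (fun x => (G x).1 i j); [exact: P1 | exists 1 => x dx].
  by rewrite /= mxE mulrA expr1 divff // mul1r.
- exists (fun x => (G x).2 i j); [exact: P2 | exists 1 => x dx].
  by rewrite /= mxE mulrA expr1 divff // mul1r.
- exists (fun x => delta x ^+ M2 * F1 x + delta x ^+ M1 * F2 x).
    by apply: falgD => //; apply: falgM => //; apply: falgX.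
  by exists (M1 + M2) => x dx; rewrite E1 // E2 // exprD; ring.
- exists (fun x => F1 x * F2 x); first exact: falgM.
  by exists (M1 + M2) => x dx; rewrite E1 // E2 // exprD; ring.
Qed.

End FunctionAlgebra.

Lemma polyfun_falg (K : fieldType) n : falg (@polyfun K n).
Proof. by split; [exact: pf_const | exact: pf_add | exact: pf_mul]. Qed.

Lemma polyfun_mx1 (K : fieldType) n : mxfalg (@polyfun K n) (fun x => x.1).
Proof. by move=> i j; apply: pf_coord1. Qed.

Lemma polyfun_mx2 (K : fieldType) n : mxfalg (@polyfun K n) (fun x => x.2).
Proof. by move=> i j; apply: pf_coord2. Qed.

(** * Zariski closure and polynomial curves *)

Section Closure.
Variable K : numClosedFieldType.

Definition upoly (f : K -> K) := exists p : {poly K}, forall s, f s = p.[s].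

Lemma upoly_falg : falg upoly.
Proof.
split=> [c|f g [p fE] [q gE]|f g [p fE] [q gE]].
- by exists c%:P => s; rewrite hornerC.
- by exists (p + q) => s; rewrite fE gE hornerD.
- by exists (p * q) => s; rewrite fE gE hornerM.
Qed.

Lemma upoly_id : upoly id.
Proof. by exists 'X => s; rewrite hornerX. Qed.

Lemma poly_neq0_root (p : {poly K}) : p != 0 -> exists s, p.[s] != 0.
Proof.
move=> p0; have [//|nex] := pselect (exists s, p.[s] != 0).
case/eqP: p0; apply: (@roots_geq_poly_eq0 _ _ [seq i%:R | i <- iota 0 (size p)]).
- apply/allP=> s _; apply: contrapT => /negP ps; apply: nex; exists s.
  by rewrite -rootE.
- rewrite map_inj_uniq ?iota_uniq // => i j /eqP.
  by rewrite eqr_nat => /eqP.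
- by rewrite size_map size_iota.
Qed.

Lemma upoly_neq0M (f g : K -> K) s1 s2 : upoly f -> upoly g ->
  f s1 != 0 -> g s2 != 0 -> exists s, (f s != 0) && (g s != 0).
Proof.
move=> [p fE] [q gE]; rewrite fE gE => ps qs.
have p0 : p != 0 by apply: contraNneq ps => ->; rewrite horner0.
have q0 : q != 0 by apply: contraNneq qs => ->; rewrite horner0.
have [s] := poly_neq0_root (mulf_neq0 p0 q0).
by rewrite hornerM mulf_eq0 negb_or => H; exists s; rewrite fE gE.
Qed.

Lemma upoly_generic0 (f h : K -> K) s0 : upoly f -> upoly h -> h s0 != 0 ->
  (forall s, h s != 0 -> f s = 0) -> forall s, f s = 0.
Proof.
move=> Uf Uh hs fh s; apply: contrapT => /eqP fs.
by have [u /andP[fu /fh/eqP]] := upoly_neq0M Uf Uh fs hs; rewrite (negPf fu).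
Qed.

Variable n : nat.
Implicit Types (S Z : pset K n) (x : mxpair K n).

Lemma zclosureP S x :
  zclosure S x <-> (forall f, polyfun f -> (forall y, S y -> f y = 0) -> f x = 0).
Proof.
split=> [clx f pf fS|H Z [F [Fp ZF]] SZ].
  apply: (clx (fun y => f y = 0)) => // {x clx}; exists (eq^~ f).
  by split=> [_ ->|x] //; split=> [fx _ ->|->].
by apply/ZF=> f Ff; apply: H => [|y /SZ/ZF]; [exact: Fp | exact].
Qed.

Lemma zclosed_closure S : zclosed (zclosure S).
Proof.
exists (fun f => polyfun f /\ forall y, S y -> f y = 0).
split=> [f []//|x]; split=> [/zclosureP H f []|H]; first exact: H.
by apply/zclosureP=> f pf fS; apply: H.
Qed.

Lemma sub_zclosure S x : S x -> zclosure S x.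
Proof. by move=> Sx Z _; apply. Qed.

Lemma zclosure_min S Z : zclosed Z -> psubset S Z -> psubset (zclosure S) Z.
Proof. by move=> cZ SZ x; apply. Qed.

Lemma zclosure_mono S Z : psubset S Z -> psubset (zclosure S) (zclosure Z).
Proof.
by move=> SZ; apply: zclosure_min (zclosed_closure Z) _ => x /SZ; apply: sub_zclosure.
Qed.

Lemma zclosed_polyfun0 (f : mxpair K n -> K) : polyfun f -> zclosed (fun x => f x = 0).
Proof.
by move=> pf; exists (eq^~ f); split=> [_ ->|x] //; split=> [fx _ ->|->].
Qed.

(** A polynomial vanishing on S, pulled back to the curve and cleared of denominators, is a
    polynomial in s that vanishes wherever [w] and [delta] do not, hence everywhere. *)
Lemma zclosure_rat_curve S (G : K -> mxpair K n) (delta w : K -> K) s0 s1 :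
  upoly delta -> mxfalg upoly (fun s => (G s).1) -> mxfalg upoly (fun s => (G s).2) ->
  upoly w -> w s1 != 0 ->
  (forall s, w s != 0 -> delta s != 0 ->
    S ((delta s)^-1 *: (G s).1, (delta s)^-1 *: (G s).2)) ->
  delta s0 != 0 ->
  zclosure S ((delta s0)^-1 *: (G s0).1, (delta s0)^-1 *: (G s0).2).
Proof.
move=> Ud U1 U2 Uw ws1 SG ds0; apply/zclosureP=> f pf fS.
have [F UF [M FE]] := falg_polyfun_rat upoly_falg Ud U1 U2 pf.
have [s2 /andP[ws2 ds2]] := upoly_neq0M Uw Ud ws1 ds0.
have F0 : F s0 = 0.
  apply: (upoly_generic0 (s0 := s2) UF (falgM upoly_falg Uw Ud)).
    exact: mulf_neq0.
  move=> s; rewrite mulf_eq0 negb_or => /andP[ws ds].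
  by rewrite FE // fS ?mulr0 //; apply: SG.
move/eqP: F0; rewrite FE // mulf_eq0 expf_eq0 (negPf ds0) andbF /=.
by move/eqP.
Qed.

Lemma zclosure_curve S (G : K -> mxpair K n) (w : K -> K) s0 s1 :
  mxfalg upoly (fun s => (G s).1) -> mxfalg upoly (fun s => (G s).2) ->
  upoly w -> w s1 != 0 -> (forall s, w s != 0 -> S (G s)) ->
  zclosure S (G s0).
Proof.
move=> U1 U2 Uw ws1 SG.
have E s : G s = (1^-1 *: (G s).1, 1^-1 *: (G s).2).
  by rewrite invr1 !scale1r -surjective_pairing.
rewrite E; apply: (zclosure_rat_curve (falgC upoly_falg 1) U1 U2 Uw ws1).
  by move=> s /SG; rewrite {1}E.
exact: oner_neq0.
Qed.

Lemma zclosure_sub S T : psubset S (zclosure T) -> psubset (zclosure S) (zclosure T).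
Proof. by move=> ST; apply: zclosure_min (zclosed_closure T) ST. Qed.

Lemma zclosure_bigU (I : eqType) (r : seq I) (S : I -> pset K n) x :
  zclosure (fun y => exists2 i, i \in r & S i y) x ->
  exists2 i, i \in r & zclosure (S i) x.
Proof.
move=> clx; apply: contrapT => nex.
(* For each i in r, a polynomial separates x from [S i]; the product of these vanishes on the union
   but not at x. Outside r the zero function is a dummy. *)
have H (i : I) : {f | polyfun f /\ (forall y, S i y -> f y = 0) & i \in r -> f x <> 0}.
  apply: cid2; case: (boolP (i \in r)) => ir; last first.
    exists (fun=> 0) => //; split=> //; exact: pf_const.
  apply: contrapT => nf; case: nex; exists i => //; apply/zclosureP=> f pf fS.
  by apply: contrapT => fx; case: nf; exists f.
pose f i := s2val (H i).
have : \prod_(i <- r) f i x = 0.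
  move/zclosureP: clx => /(_ (fun y => \prod_(i <- r) f i y)); apply.
    by apply: (falg_prod (polyfun_falg _ _)) => i _; rewrite /f; case: (H i) => ? [].
  move=> y [i ir Siy]; apply/eqP; rewrite prodf_seq_eq0; apply/hasP; exists i => //=.
  by rewrite /f; case: (H i) => g [_ gS] _ /=; rewrite (gS y).
move/eqP; rewrite prodf_seq_eq0 => /hasP[i ir /=]; rewrite /f.
by case: (H i) => g _ /= /(_ ir) gx /eqP.
Qed.

(** The tail of the union enters as its closure, which is closed by construction; [zclosure_bigU]
    then shows that taking the closure added nothing. *)
Lemma zirreducible_bigU (I : eqType) (r : seq I) (S : I -> pset K n) Z :
  zirreducible Z -> (forall i, zclosed (S i)) ->
  (forall x, Z x -> exists2 i, i \in r & S i x) ->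
  exists2 i, i \in r & psubset Z (S i).
Proof.
move=> [_ [x0 Zx0] irrZ] cS; elim: r => [|i r IHr] ZS; first by have [] := ZS _ Zx0.
have cU : zclosed (zclosure (fun y => exists2 i, i \in r & S i y)).
  exact: zclosed_closure.
case: (irrZ _ _ (cS i) cU) => [x /ZS[j]||].
- rewrite inE => /orP[/eqP->|jr Sjx]; [by left | right].
  by apply: sub_zclosure; exists j.
- by exists i => //; rewrite mem_head.
move=> ZU; case: IHr => [x /ZU/zclosure_bigU[j jr clj]|j jr Zj].
  by exists j => //; apply: zclosure_min clj => //; apply: cS.
by exists j => //; rewrite inE jr orbT.
Qed.

End Closure.

Lemma zclosure_preim (K : numClosedFieldType) m n (S : pset K n) (T : pset K m)
    (G : mxpair K n -> mxpair K m) :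
  mxfalg (@polyfun K n) (fun x => (G x).1) -> mxfalg (@polyfun K n) (fun x => (G x).2) ->
  (forall x, S x -> zclosure T (G x)) -> forall x, zclosure S x -> zclosure T (G x).
Proof.
move=> P1 P2 SG x /zclosureP Sx; apply/zclosureP=> f pf fT.
apply: (Sx (fun y => f (G y))).
  exact: (falg_polyfun (polyfun_falg _ _)).
by move=> y /SG/zclosureP; apply.
Qed.

(** * Algebraic dependence and chains of irreducible closed sets *)

(** Exponent vectors with entries below M, nested so that the exponent of the last function comes
    first and induction on d peels it off. *)
Fixpoint expo (M d : nat) : finType :=
  if d is d'.+1 then ('I_M * expo M d')%type : finType else unit.

Fixpoint monom (K : fieldType) (X : Type) (f : nat -> X -> K) M d : expo M d -> X -> K :=
  if d is d'.+1 then fun e x => f d' x ^+ e.1 * monom f e.2 x else fun=> fun=> 1.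

Lemma card_expo M d : #|expo M d| = (M ^ d)%N.
Proof.
by elim: d => [|d IHd]; rewrite ?card_unit //= card_prod card_ord IHd expnS.
Qed.

Lemma falg_monom (K : fieldType) X (P : (X -> K) -> Prop) (f : nat -> X -> K) M d
    (e : expo M d) : falg P -> (forall k, (k < d)%N -> P (f k)) -> P (monom f e).
Proof.
move=> PA; elim: d e => [|d IHd] e Pf; first exact: falgC.
apply: falgM => //; first by apply: falgX => //; apply: Pf.
by apply: IHd => k kd; apply: Pf; apply: ltnW.
Qed.

Lemma monom_comp (K : fieldType) X Y (f : nat -> X -> K) (g : Y -> X) M d (e : expo M d) y :
  monom f e (g y) = monom (fun k y => f k (g y)) e y.
Proof. by elim: d e => //= d IHd e; rewrite IHd. Qed.

Section ChainIndependence.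
Variables (K : numClosedFieldType) (n : nat) (c : nat -> pset K n).
Variable f : nat -> mxpair K n -> K.

(* Restricting to c d, where f d vanishes, isolates the lowest power of f d. *)
Lemma chain_independent M d (a : expo M d -> K) :
  (forall k, (k <= d)%N -> zirreducible (c k)) ->
  (forall k, (k < d)%N -> psubset (c k) (c k.+1)) ->
  (forall k, (k < d)%N -> polyfun (f k)) ->
  (forall k x, (k < d)%N -> c k x -> f k x = 0) ->
  (forall k, (k < d)%N -> exists2 x, c k.+1 x & f k x != 0) ->
  (forall x, c d x -> \sum_e a e * monom f e x = 0) -> forall e, a e = 0.
Proof.
elim: d a => [|d IHd] a irr sub pf f0 fN0 rel.
  have [_ [x cx] _] := irr 0 (leqnn 0).
  case; have := rel x cx; rewrite (bigD1 tt) //= big1 ?addr0 ?mulr1 //.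
(* The coefficient of the j-th power of [f d] in the relation. *)
pose F j x := \sum_(e : expo M d) a (j, e) * monom f e x.
have pF j : polyfun (F j).
  apply: (falg_sum (polyfun_falg _ _)) => e _; apply: pf_mul; first exact: pf_const.
  by apply: (falg_monom _ (polyfun_falg _ _)) => k kd; apply: pf; apply: ltnW.
have relF x : c d.+1 x -> \sum_(j < M) f d x ^+ j * F j x = 0.
  move=> cx; rewrite -[RHS](rel x cx).
  transitivity (\sum_(j < M) \sum_(e : expo M d) a (j, e) * (f d x ^+ j * monom f e x)).
    by apply: eq_bigr => j _; rewrite mulr_sumr; apply: eq_bigr => e _; ring.
  by rewrite pair_bigA; apply: eq_bigr; case.
suff a0 k (j : 'I_M) e : (j < k)%N -> a (j, e) = 0 by case=> j e; apply: (a0 M).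
elim: k j e => [//|k IHk] j e jk.
have [/IHk//|kj] := ltnP j k; have {jk kj} jk : j = k :> nat by lia.
(* The coefficients below j are already zero, so the relation is [f d] to the power j times [G]. *)
pose G x := \sum_(i < M | (j <= i)%N) f d x ^+ (i - j) * F i x.
have pG : polyfun G.
  apply: (falg_sum (polyfun_falg _ _)) => i _; apply: pf_mul => //.
  by apply: (falgX (polyfun_falg _ _)); apply: pf.
(* By irreducibility of [c d.+1], one of [f d] and [G] vanishes on it, and [fN0] excludes the
   first. *)
have G0 x : c d.+1 x -> G x = 0.
  have [_ _ /(_ _ _ (zclosed_polyfun0 (pf d (ltnSn d))) (zclosed_polyfun0 pG))] :=
    irr _ (leqnn d.+1).
  case=> [y cy|fd|]; last by apply.
    have /eqP := relF y cy; rewrite (bigID (fun i : 'I_M => (j <= i)%N)) /=.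
    rewrite [X in _ + X]big1 ?addr0 => [|i ij]; last first.
      by rewrite [F i y]big1 ?mulr0 // => e' _; rewrite IHk ?mul0r //; lia.
    rewrite (_ : \sum_(i < M | _) _ = f d y ^+ j * G y).
      by rewrite mulf_eq0 expf_eq0 => /orP[/andP[_ /eqP]|/eqP]; [left | right].
    rewrite mulr_sumr; apply: eq_bigr => i ji.
    by rewrite mulrA -exprD subnKC.
  by move=> cx; have [y /fd ->] := fN0 d (ltnSn d); rewrite eqxx.
apply: (IHd (fun e => a (j, e))) => //.
- by move=> i ?; apply: irr; apply: ltnW.
- by move=> i ?; apply: sub; apply: ltnW.
- by move=> i ?; apply: pf; apply: ltnW.
- by move=> i x ? cx; apply: f0 => //; apply: ltnW.
- by move=> i ?; apply: fN0; apply: ltnW.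
move=> x cx; have := G0 x (sub d (ltnSn d) x cx).
rewrite /G (bigD1 j) //= subnn expr0 mul1r big1 ?addr0 // => i /andP[ji ij].
rewrite (f0 d x) // expr0n subn_eq0 (_ : (i <= j)%N = false) ?mul0r //.
by apply/negbTE; rewrite -ltnNge ltn_neqAle ji andbT eq_sym.
Qed.

End ChainIndependence.

(** * Algebraic dependence of N + 1 polynomial functions of N variables *)

Section Dependence.
Variables (K : numClosedFieldType) (N : nat).
Local Notation U := {ffun 'I_N -> K}.
Implicit Types (F G : U -> K) (u : U).

Definition upd u i s : U := [ffun j => if j == i then s else u j].

(** Degree at most D in each variable separately, expressed through univariate polynomials on
    coordinate lines. *)
Definition pdeg D F := forall i u, exists2 p : {poly K},
  (size p <= D.+1)%N & forall s, F (upd u i s) = p.[s].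

Definition pbounded F := exists D, pdeg D F.

Lemma pdeg_mono D E F : (D <= E)%N -> pdeg D F -> pdeg E F.
Proof. by move=> DE pF i u; have [p ps pE] := pF i u; exists p => //; lia. Qed.

Lemma pdegC D a : pdeg D (fun=> a).
Proof.
by move=> i u; exists a%:P => [|s]; rewrite ?hornerC // size_polyC; case: eqP.
Qed.

Lemma pdegM D E F G : pdeg D F -> pdeg E G -> pdeg (D + E) (fun u => F u * G u).
Proof.
move=> pF pG i u; have [p ps pE] := pF i u; have [q qs qE] := pG i u.
exists (p * q) => [|s]; last by rewrite hornerM pE qE.
by apply: leq_trans (size_polyMleq _ _) _; lia.
Qed.

Lemma pdegD D E F G : pdeg D F -> pdeg E G -> pdeg (D + E) (fun u => F u + G u).
Proof.
move=> pF pG i u; have [p ps pE] := pF i u; have [q qs qE] := pG i u.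
exists (p + q) => [|s]; last by rewrite hornerD pE qE.
by apply: leq_trans (size_polyD _ _) _; rewrite geq_max; apply/andP; split; lia.
Qed.

Lemma pbounded_falg : falg pbounded.
Proof.
split=> [a|F G [D pF] [E pG]|F G [D pF] [E pG]].
- by exists 0; apply: pdegC.
- by exists (D + E)%N; apply: pdegD.
- by exists (D + E)%N; apply: pdegM.
Qed.

Lemma pbounded_coord i : pbounded (fun u => u i).
Proof.
exists 1 => j u; case ij: (i == j).
  by exists 'X => [|s]; rewrite ?size_polyX // hornerX ffunE ij.
by exists (u i)%:P => [|s]; rewrite ?hornerC ?ffunE ?ij // size_polyC; case: eqP.
Qed.

Lemma pdegX D F k : pdeg D F -> pdeg (k * D) (fun u => F u ^+ k).
Proof.
move=> pF; elim: k => [|k IHk]; first exact: pdegC.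
rewrite mulSn (_ : (fun u => F u ^+ k.+1) = (fun u => F u * F u ^+ k)); last by apply/funext => u; rewrite exprS.
exact: pdegM pF IHk.
Qed.

Lemma pdeg_monom D M d (f : nat -> U -> K) (e : expo M d) :
  (forall k, (k < d)%N -> pdeg D (f k)) -> pdeg (d * (M * D)) (monom f e).
Proof.
elim: d e => [|d IHd] e pf; first exact: pdegC.
rewrite mulSn; apply: pdegM.
  apply: pdeg_mono (pdegX e.1 (pf d (ltnSn d))).
  by rewrite leq_mul2r ltnW ?orbT.
by apply: IHd => k kd; apply: pf; apply: ltnW.
Qed.

Lemma pdeg_sum D (I : finType) (F : I -> U -> K) :
  (forall i, pdeg D (F i)) -> pdeg D (fun u => \sum_i F i u).
Proof.
move=> pF i u; have H j : {p : {poly K} | (size p <= D.+1)%N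
    & forall s, F j (upd u i s) = p.[s]} := cid2 (pF j i u).
exists (\sum_j s2val (H j)) => [|s].
  apply: leq_trans (size_sum _ _ _) _; apply/bigmax_leqP => j _.
  by case: (H j).
rewrite horner_sum; apply: eq_bigr => j _.
by case: (H j).
Qed.

(** A univariate polynomial of degree at most D with the D + 1 roots 0, ..., D is zero, so
    coordinates leave the grid one at a time; in [H] those below k are arbitrary. *)
Lemma pdeg_grid D F : pdeg D F ->
  (forall v : {ffun 'I_N -> 'I_D.+1}, F [ffun i => (v i)%:R] = 0) -> forall u, F u = 0.
Proof.
move=> pF F0.
suff H k u : (forall i : 'I_N, (k <= i)%N -> exists m : 'I_D.+1, u i = m%:R) -> F u = 0.
  by move=> u; apply: (H N) => i; rewrite leqNgt ltn_ord.
elim: k u => [|k IHk] u gu.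
  pose v := [ffun i => s2val (cid2 (ex_intro2 _ _ _ erefl (proj2_sig (cid (gu i isT)))))].
  have -> : u = [ffun i => (v i)%:R]; last exact: F0.
  by apply/ffunP=> i; rewrite !ffunE; case: cid2 => m /= _ ->.
have [kN|Nk] := ltnP k N; last first.
  by apply: IHk => i ki; have := ltn_ord i; lia.
pose i := Ordinal kN; have [p ps pE] := pF i u.
have uE : u = upd u i (u i) by apply/ffunP=> j; rewrite ffunE; case: eqP => [->|].
suff p0 : p = 0 by rewrite uE pE p0 horner0.
apply: (@roots_geq_poly_eq0 _ _ [seq m%:R | m <- iota 0 D.+1]).
- apply/allP=> _ /mapP[m mD ->]; rewrite rootE -pE; apply/eqP; apply: IHk => j kj.
  rewrite ffunE; case: eqP => [_|/eqP ji].
    by rewrite mem_iota in mD; exists (Ordinal mD).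
  by apply: gu; rewrite ltn_neqAle kj andbT; apply: contra ji => /eqP e; apply/eqP/val_inj.
- by rewrite map_inj_uniq ?iota_uniq // => a b /eqP; rewrite eqr_nat => /eqP.
- by rewrite size_map size_iota.
Qed.

(** The M^(N+1) monomials with exponents below M have degree at most E in each variable, so they are
    determined by (E+1)^N grid values. For large M there are more monomials than values. *)
Lemma algebraic_dependence (f : nat -> U -> K) :
  (forall k, pbounded (f k)) ->
  exists M (a : expo M N.+1 -> K),
    (exists e, a e != 0) /\ forall u, \sum_e a e * monom f e u = 0.
Proof.
move=> pf; have H k : {D | pdeg D (f k)} := cid (pf k).
pose D := \max_(k < N.+1) sval (H k).
have pfD k : (k < N.+1)%N -> pdeg D (f k).
  move=> kN; apply: pdeg_mono (svalP (H k)).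
  exact: (@leq_bigmax _ (fun k : 'I_N.+1 => sval (H k)) (Ordinal kN)).
(* C M = E + M bounds E + 1, and M > C^N makes (C M)^N smaller than M^(N+1). *)
pose C := (N.+1 * D).+1; pose M := (C ^ N).+1; exists M.
pose E := (N.+1 * (M * D))%N.
have EM : (E.+1 ^ N < M ^ N.+1)%N.
  apply: (@leq_ltn_trans ((C * M) ^ N)).
    have [->//|N0] := posnP N; rewrite leq_exp2r //.
    have -> : (C * M = M + E)%N by rewrite /C /E mulSn mulnA mulnAC.
    by rewrite -[ltnLHS]add0n ltn_add2r.
  by rewrite expnMn expnS ltn_mul2r expn_gt0 /= /M ltnS leqnn.
pose grid (v : {ffun 'I_N -> 'I_E.+1}) : U := [ffun i => (v i)%:R].
pose A : 'M[K]_(#|expo M N.+1|, #|{ffun 'I_N -> 'I_E.+1}|) :=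
  \matrix_(i, j) monom f (enum_val i) (grid (enum_val j)).
have /rowV0Pn[w /sub_kermxP wA w0] : kermx A != 0.
  rewrite -mxrank_eq0 mxrank_ker -lt0n subn_gt0.
  apply: leq_ltn_trans (rank_leq_col A) _.
  by rewrite card_ffun !card_ord card_expo.
exists (fun e => w 0 (enum_rank e)); split.
  have /rV0Pn[j wj] : w != 0 := w0.
  by exists (enum_val j); rewrite enum_valK.
apply: (@pdeg_grid E).
  apply: pdeg_sum => e; rewrite -[E]add0n; apply: pdegM; first exact: pdegC.
  by apply: pdeg_monom.
move=> v; have /matrixP/(_ 0 (enum_rank v)) := wA.
rewrite mxE [RHS]mxE => E0; rewrite -[RHS]E0.
rewrite (reindex enum_val (onW_bij _ (enum_val_bij _))) /=.
by apply: eq_bigr => i _; rewrite !mxE enum_valK enum_rankK.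
Qed.

End Dependence.

(** * Parametrization of the strata *)

Section Parametrization.
Variables (K : numClosedFieldType) (n' p m r : nat).
Local Notation n := n'.+1.
Hypothesis dim_eq : (2 * p + m + r = n)%N.
Implicit Types (a : nat -> K) (i j : 'I_n).

(* Indices of equal, resp. opposite, diagonal entries of A0. *)
Definition tp_same (i j : nat) := (i == j) || ((2 * p + m <= i) && (2 * p + m <= j))%N.
Definition tp_opp (i j : nat) :=
  ([&& i < 2 * p, j < 2 * p, i != j & i./2 == j./2] ||
   ((2 * p + m <= i) && (2 * p + m <= j)))%N.

Definition good_disc a : K :=
  \prod_(i < p + m) (a i * \prod_(j < p + m | j != i) ((a i - a j) * (a i + a j))).

Lemma good_discP a : good_disc a != 0 <-> good_params p m a.
Proof.
split=> [/prodf_neq0 gd|[a0 aij]].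
  split=> [i ilt|i j ilt jlt ij].
    by have := gd (Ordinal ilt) isT; rewrite mulf_eq0 negb_or => /andP[].
  have := gd (Ordinal ilt) isT; rewrite mulf_eq0 negb_or => /andP[_ /prodf_neq0].
  move/(_ (Ordinal jlt)); rewrite -val_eqE /= eq_sym => /(_ ij).
  by rewrite mulf_eq0 negb_or subr_eq0 addr_eq0 => /andP[].
apply/prodf_neq0 => i _; rewrite mulf_neq0 ?a0 //; apply/prodf_neq0 => j ji.
have [|ne nep] := aij i j (ltn_ord i) (ltn_ord j); first by rewrite eq_sym.
by rewrite mulf_neq0 // ?subr_eq0 ?addr_eq0.
Qed.

(** Each nonzero diagonal entry is a sign times one [a k]; for good a, equality and opposition of
    entries reduce to comparing indices and signs. *)
Definition tp_sgn (i : nat) := (i < 2 * p)%N && odd i.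
Definition tp_idx (i : nat) := if (i < 2 * p)%N then i./2 else (i - p)%N.

Lemma tp_diagE a (i : nat) :
  tp_diag p m a i = if (i < 2 * p + m)%N then (-1) ^+ tp_sgn i * a (tp_idx i) else 0.
Proof.
rewrite /tp_diag /tp_sgn /tp_idx; case: ltnP => i2p /=.
  by rewrite ltn_addr //; case: odd; rewrite ?mulN1r ?mul1r.
by case: ifP => // _; rewrite mul1r.
Qed.

Lemma tp_idx_lt (i : nat) : (i < 2 * p + m)%N -> (tp_idx i < p + m)%N.
Proof. by clear dim_eq; rewrite /tp_idx; case: (ltnP i (2 * p)); lia. Qed.

Lemma signed_eq0 a (e f : bool) k l : good_params p m a -> (k < p + m)%N -> (l < p + m)%N ->
  ((-1) ^+ e * a k + (-1) ^+ f * a l == 0) = (k == l) && (e != f).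
Proof.
move=> [a0 aij] kl ll; have [<-|kl'] := eqVneq k l.
  rewrite -mulrDl mulf_eq0 (negPf (a0 _ kl)) orbF.
  case: e; case: f; rewrite ?subrr ?addNr ?eqxx //= -?opprD ?oppr_eq0.
    by rewrite (_ : 1 + 1 = 2%:R) ?pnatr_eq0 //; ring.
  by rewrite (_ : 1 + 1 = 2%:R) ?pnatr_eq0 //; ring.
have [ne nep] := aij k l kl ll kl'; apply/negbTE.
by case: e; case: f; rewrite /= ?mulN1r ?mul1r ?addr_eq0 ?opprK ?eqr_opp // eqr_oppLR.
Qed.

Lemma tp_diagD_eq0 a (i j : nat) : good_params p m a ->
  (tp_diag p m a i + tp_diag p m a j == 0) = tp_opp i j.
Proof.
move=> ga; rewrite !tp_diagE /tp_opp; case: ltnP => il; case: ltnP => jl /=.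
- rewrite signed_eq0 ?tp_idx_lt // /tp_sgn /tp_idx orbF; apply/idP/idP.
    by case: (ltnP i); case: (ltnP j); lia.
  by case: (ltnP i); case: (ltnP j); lia.
- rewrite addr0 mulf_eq0 signr_eq0 (negPf (ga.1 _ (tp_idx_lt il))); lia.
- rewrite add0r mulf_eq0 signr_eq0 (negPf (ga.1 _ (tp_idx_lt jl))); lia.
- by rewrite addr0 eqxx orbT.
Qed.

Lemma tp_diag_eq a (i j : nat) : good_params p m a ->
  (tp_diag p m a i == tp_diag p m a j) = tp_same i j.
Proof.
move=> ga; rewrite -subr_eq0 !tp_diagE /tp_same; case: ltnP => il; case: ltnP => jl /=.
- rewrite -mulNr -signrN signed_eq0 ?tp_idx_lt // /tp_sgn /tp_idx orbF.
  apply/idP/idP.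
    by case: (ltnP i); case: (ltnP j); lia.
  by move/eqP->; rewrite eqxx; case: ltnP => _; case: odd.
- rewrite subr0 mulf_eq0 signr_eq0 (negPf (ga.1 _ (tp_idx_lt il))) /=; lia.
- rewrite sub0r oppr_eq0 mulf_eq0 signr_eq0 (negPf (ga.1 _ (tp_idx_lt jl))) /=; lia.
- by rewrite subrr eqxx orbT.
Qed.

(** Names of the parameters: entries of B, entries of g, and the numbers a_k. *)
Definition pidx : eqType := (('I_n * 'I_n) + (('I_n * 'I_n) + nat))%type.
Implicit Types (t u : pidx -> K) (J : pred pidx) (x : mxpair K n).

Definition par_g t : 'M[K]_n := \matrix_(i, j) t (inr (inl (i, j))).
Definition par_a t : nat -> K := fun k => t (inr (inr k)).
Definition par_B t : 'M[K]_n := \matrix_(i, j) if tp_opp i j then t (inl (i, j)) else 0.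
Definition dvec a : 'rV[K]_n := \row_(i < n) tp_diag p m a i.
Definition dmx a : 'M[K]_n := diag_mx (dvec a).

Definition par_ok t := \det (par_g t) * good_disc (par_a t).
Definition par_pair t : mxpair K n :=
  (par_g t *m dmx (par_a t) *m invmx (par_g t), par_g t *m par_B t *m invmx (par_g t)).
(** With the adjugate in place of the inverse the pair is polynomial in t, and too large by the
    factor [\det (par_g t)]. *)
Definition par_pair_adj t : mxpair K n :=
  (par_g t *m dmx (par_a t) *m \adj (par_g t), par_g t *m par_B t *m \adj (par_g t)).

(** Base point B = 0, g = 1, a_k = k + 1: positive integers are never opposite to each other. *)
Definition par0 : pidx -> K := fun z => match z with
  | inl _ => 0 | inr (inl (i, j)) => (i == j)%:R | inr (inr k) => k.+1%:R end.

Definition par_family J : pset K n := fun x =>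
  exists t, [/\ forall z, ~~ J z -> t z = par0 z, par_ok t != 0 & x = par_pair t].

Lemma par_pairE t : \det (par_g t) != 0 ->
  par_pair t = ((\det (par_g t))^-1 *: (par_pair_adj t).1,
                (\det (par_g t))^-1 *: (par_pair_adj t).2).
Proof.
by move=> dg; rewrite /par_pair /invmx unitmxE unitfE dg /= -!scalemxAr.
Qed.

Lemma anticomm_dmxP a (B : 'M[K]_n) : good_params p m a ->
  dmx a *m B + B *m dmx a = 0 <-> forall i j, ~~ tp_opp i j -> B i j = 0.
Proof.
move=> ga; have E i j : (dmx a *m B + B *m dmx a) i j =
    (tp_diag p m a i + tp_diag p m a j) * B i j.
  by rewrite mul_diag_mx mul_mx_diag !mxE mulrC; ring.
split=> [AB i j nij|B0].
  have /eqP := E i j; rewrite AB mxE eq_sym mulf_eq0 tp_diagD_eq0 // (negPf nij).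
  by move/eqP.
apply/matrixP=> i j; rewrite E mxE; case: (boolP (tp_opp i j)) => [|/B0->]; last exact: mulr0.
by rewrite -(tp_diagD_eq0 _ _ ga) => /eqP->; rewrite mul0r.
Qed.

Lemma comm_dmx a (h : 'M[K]_n) : good_params p m a ->
  comm_mx h (dmx a) <-> forall i j, ~~ tp_same i j -> h i j = 0.
Proof.
move=> ga; have E i j : (h *m dmx a - dmx a *m h) i j =
    (tp_diag p m a j - tp_diag p m a i) * h i j.
  by rewrite mul_diag_mx mul_mx_diag !mxE mulrC; ring.
rewrite /comm_mx; split=> [hd i j nij|h0].
  have /eqP := E i j; rewrite hd subrr mxE eq_sym mulf_eq0 subr_eq0 eq_sym.
  by rewrite tp_diag_eq // (negPf nij) => /eqP.
apply/eqP; rewrite -subr_eq0; apply/eqP/matrixP=> i j; rewrite E mxE.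
case: (boolP (tp_same i j)) => [|/h0->]; last exact: mulr0.
by rewrite -(tp_diag_eq _ _ ga) => /eqP->; rewrite subrr mul0r.
Qed.

Lemma par_B_anticomm a t : good_params p m a ->
  dmx a *m par_B t + par_B t *m dmx a = 0.
Proof. by move=> ga; apply/anticomm_dmxP=> // i j nij; rewrite mxE (negPf nij). Qed.

Lemma par_ok_split t : par_ok t != 0 ->
  par_g t \in unitmx /\ good_params p m (par_a t).
Proof.
by rewrite mulf_eq0 negb_or => /andP[dg /good_discP ga]; rewrite unitmxE unitfE.
Qed.

Lemma ZcircP x : Zcirc K n p m r x <-> par_family xpredT x.
Proof.
split=> [[_ [g [A0 [B0 [a [ug ga -> AB0 ->]]]]]]|[t [_ /par_ok_split[ug ga] ->]]].
  pose t (i : pidx) := match i with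
    | inl (i, j) => B0 i j | inr (inl (i, j)) => g i j | inr (inr k) => a k end.
  have gE : par_g t = g by apply/matrixP=> i j; rewrite mxE.
  have BE : par_B t = B0.
    apply/matrixP=> i j; rewrite mxE; case: ifP => // /negbT nij.
    by have /anticomm_dmxP -> := AB0.
  exists t; split=> //; last by rewrite /par_pair gE BE.
  rewrite /par_ok gE mulf_neq0 //; last exact/good_discP.
  by rewrite -unitfE -unitmxE.
split=> //; exists (par_g t), (dmx (par_a t)), (par_B t), (par_a t); split=> //.
exact: par_B_anticomm.
Qed.

Section Family.
Variables (X : Type) (P : (X -> K) -> Prop) (F : X -> pidx -> K).
Hypotheses (PA : falg P) (PF : forall z, P (fun y => F y z)).

Lemma falg_par_g : mxfalg P (fun y => par_g (F y)).
Proof. by move=> i j; apply: falg_ext (PF (inr (inl (i, j)))) => y; rewrite mxE. Qed.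

Lemma falg_par_B : mxfalg P (fun y => par_B (F y)).
Proof.
move=> i j; case e: (tp_opp i j).
  by apply: falg_ext (PF (inl (i, j))) => y; rewrite mxE e.
by apply: falg_ext (falgC PA 0) => y; rewrite mxE e.
Qed.

Lemma falg_par_D : mxfalg P (fun y => dmx (par_a (F y))).
Proof.
apply: mxfalg_diag => // i j; case e: (j < 2 * p + m)%N.
  have PM := falgM PA (falgC PA ((-1) ^+ tp_sgn j)) (PF (inr (inr (tp_idx j)))).
  by apply: falg_ext PM => y; rewrite mxE tp_diagE e.
by apply: falg_ext (falgC PA 0) => y; rewrite mxE tp_diagE e.
Qed.

Lemma falg_par_ok : P (fun y => par_ok (F y)).
Proof.
apply: falgM => //; first by apply: falg_det => //; apply: falg_par_g.
apply: falg_prod => // i _; apply: falgM => //; first exact: (PF (inr (inr _))).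
apply: falg_prod => // j _; apply: falgM => //; last by apply: falgD => //; apply: (PF (inr (inr _))).
by apply: falgB => //; apply: (PF (inr (inr _))).
Qed.

Lemma falg_par_adj1 : mxfalg P (fun y => (par_pair_adj (F y)).1).
Proof.
apply: mxfalgM => //; last by apply: mxfalg_adj => //; apply: falg_par_g.
by apply: mxfalgM => //; [apply: falg_par_g | apply: falg_par_D].
Qed.

Lemma falg_par_adj2 : mxfalg P (fun y => (par_pair_adj (F y)).2).
Proof.
apply: mxfalgM => //; last by apply: mxfalg_adj => //; apply: falg_par_g.
by apply: mxfalgM => //; [apply: falg_par_g | apply: falg_par_B].
Qed.

End Family.

Lemma good_params_succ : good_params p m (fun k => k.+1%:R : K).
Proof.
split=> [i _|i j _ _ ij]; first by rewrite pnatr_eq0.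
by rewrite eqr_nat eqSS ij -addr_eq0 -natrD pnatr_eq0.
Qed.

Lemma par_g0 : par_g par0 = 1%:M.
Proof. by apply/matrixP=> i j; rewrite !mxE. Qed.

Lemma par_ok0 : par_ok par0 != 0.
Proof.
rewrite /par_ok par_g0 det1 mul1r; apply/good_discP; exact: good_params_succ.
Qed.

(** If neither closed set contains the family, parameters t1 and t2 witness this. On the line
    through t1 and t2, where frozen parameters stay frozen, a generic point lies outside both
    sets. *)
Lemma zirreducible_par_family J : zirreducible (zclosure (par_family J)).
Proof.
split; first exact: zclosed_closure.
  by exists (par_pair par0); apply: sub_zclosure; exists par0; split=> //; apply: par_ok0.
move=> Z1 Z2 cZ1 cZ2 SZ; apply: contrapT => /not_orP[nS1 nS2].
have wit Z : zclosed Z -> ~ psubset (zclosure (par_family J)) Z ->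
    exists t f, [/\ forall z, ~~ J z -> t z = par0 z, par_ok t != 0, polyfun f,
                    forall y, Z y -> f y = 0 & f (par_pair t) != 0].
  move=> cZ nS; apply: contrapT => nex; apply: nS; apply: zclosure_min => // _ [t [tJ tok ->]].
  have [G [Gp ZG]] := cZ; apply/ZG=> f Gf; apply: contrapT => ft; apply: nex.
  exists t, f; split=> //; [exact: Gp | by move=> y /ZG; apply | exact/eqP].
have [t1 [f1 [t1J t1ok pf1 f1Z f1t]]] := wit _ cZ1 nS1.
have [t2 [f2 [t2J t2ok pf2 f2Z f2t]]] := wit _ cZ2 nS2.
pose L s : pidx -> K := fun z => (1 - s) * t1 z + s * t2 z.
have UL z : upoly (fun s => L s z).
  apply: (falgD (upoly_falg K)); apply: (falgM (upoly_falg K)).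
  - by apply: (falgB (upoly_falg K)); [apply: (falgC (upoly_falg K)) | apply: upoly_id].
  - exact: (falgC (upoly_falg K)).
  - exact: upoly_id.
  - exact: (falgC (upoly_falg K)).
have L0 : L 0 = t1 by apply/funext=> i; rewrite /L subr0 mul1r mul0r addr0.
have L1 : L 1 = t2 by apply/funext=> i; rewrite /L subrr mul1r mul0r add0r.
have UA := upoly_falg K.
have Ud : upoly (fun s => \det (par_g (L s))) by apply: falg_det => //; apply: falg_par_g.
have Uok := falg_par_ok UA UL.
have dN0 t : par_ok t != 0 -> \det (par_g t) != 0.
  by case/par_ok_split; rewrite unitmxE unitfE.
have [F1 UF1 [M1 F1E]] :=
  falg_polyfun_rat UA Ud (falg_par_adj1 UA UL) (falg_par_adj2 UA UL) pf1.
have [F2 UF2 [M2 F2E]] :=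
  falg_polyfun_rat UA Ud (falg_par_adj1 UA UL) (falg_par_adj2 UA UL) pf2.
have FN0 (F : K -> K) M f s t : (forall s, \det (par_g (L s)) != 0 -> F s =
    \det (par_g (L s)) ^+ M * f ((\det (par_g (L s)))^-1 *: (par_pair_adj (L s)).1,
      (\det (par_g (L s)))^-1 *: (par_pair_adj (L s)).2)) -> L s = t ->
    par_ok t != 0 -> f (par_pair t) != 0 -> F s != 0.
  move=> FE Ls tok ft; have dt := dN0 _ tok.
  by rewrite FE Ls // -par_pairE // mulf_neq0 // expf_neq0.
have F1N0 := FN0 _ _ _ _ _ F1E L0 t1ok f1t.
have F2N0 := FN0 _ _ _ _ _ F2E L1 t2ok f2t.
have ok0 : par_ok (L 0) != 0 by rewrite L0.
have [s1 /andP[F1s oks]] := upoly_neq0M UF1 Uok F1N0 ok0.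
have [s /andP[/[swap] F2s]] :=
  upoly_neq0M (falgM UA UF1 Uok) UF2 (mulf_neq0 F1s oks) F2N0.
rewrite mulf_eq0 negb_or => /andP[{}F1s {}oks].
have ds := dN0 _ oks.
have SL : par_family J (par_pair (L s)).
  by exists (L s); split=> // i nJ; rewrite /L t1J // t2J //; ring.
have [/f1Z f0|/f2Z f0] := SZ _ (sub_zclosure SL).
  by move: F1s; rewrite F1E // -par_pairE // f0 mulr0 eqxx.
by move: F2s; rewrite F2E // -par_pairE // f0 mulr0 eqxx.
Qed.

Lemma zirreducible_Zpmr : zirreducible (Zpmr K n p m r).
Proof.
rewrite /Zpmr (_ : Zcirc K n p m r = par_family xpredT); first exact: zirreducible_par_family.
by apply/funext=> x; apply/propext/ZcircP.
Qed.

End Parametrization.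

(** * A slice for the conjugation action *)

Section Slice.
Variables (K : numClosedFieldType) (n' p m r : nat).
Local Notation n := n'.+1.
Hypothesis dim_eq : (2 * p + m + r = n)%N.
Local Notation pidx := (pidx n').
Implicit Types (t : pidx -> K) (J : pred pidx).

Lemma sum_nat_geq (a b : nat) : (\sum_(j < b) (a <= j) = b - a)%N.
Proof.
elim: b => [|b IHb]; first by rewrite big_ord0.
by rewrite big_ord_recr /= IHb; case: leqP; lia.
Qed.

Lemma sum_nat_blocks (b c : nat) :
  (\sum_(i < n) (if i < 2 * p then b else if i < 2 * p + m then 0 else c)
   = 2 * p * b + r * c)%N.
Proof.
rewrite -(big_mkord xpredT (fun i => if i < 2 * p then b
    else if i < 2 * p + m then 0 else c)%N) -dim_eq.
rewrite (@big_cat_nat _ _ _ (2 * p + m)) /=; [|lia..].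
rewrite (@big_cat_nat _ _ _ (2 * p)) /=; [|lia..].
rewrite (eq_big_nat _ _ (F2 := fun=> b)) => [|i]; last by move/andP=> [_ ->].
rewrite [X in (_ + X + _)%N](eq_big_nat _ _ (F2 := fun=> 0%N)) => [|i]; last first.
  by case/andP=> i1 i2; rewrite ltnNge i1 i2.
rewrite [X in (_ + X)%N](eq_big_nat _ _ (F2 := fun=> c)) => [|i]; last first.
  by case/andP=> i1 i2; rewrite !ltnNge i1 (leq_trans _ i1) // leq_addr.
by rewrite !sum_nat_const_nat; lia.
Qed.

Lemma card_pair_pred (P : rel 'I_n) :
  #|[pred ij : 'I_n * 'I_n | P ij.1 ij.2]| = (\sum_(i < n) \sum_(j < n) P i j)%N.
Proof.
rewrite pair_bigA /= -sum1_card big_mkcond /=; apply: eq_bigr => ij _.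
by rewrite inE; case: (P _ _).
Qed.

(** Each of the first 2p rows has one opposite index, the next m rows have none, and the last r rows
    contribute a full r by r block. *)
Lemma card_opp : #|[pred ij : 'I_n * 'I_n | tp_opp p m ij.1 ij.2]| = (2 * p + r ^ 2)%N.
Proof.
rewrite (card_pair_pred (fun i j => tp_opp p m i j)).
have rowE (i : 'I_n) : (\sum_(j < n) tp_opp p m i j)%N =
    (if i < 2 * p then 1 else if i < 2 * p + m then 0 else r)%N.
  case: ltnP => i1; last case: ltnP => i2.
  - have jn : ((if odd i then i.-1 else i.+1) < n)%N by case: ifP; lia.
    rewrite (bigD1 (Ordinal jn)) //= big1 ?addn0 => [|j]; last first.
      by rewrite -val_eqE /=; case: ifP; rewrite /tp_opp; lia.
    by rewrite /tp_opp; case: ifP; lia.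
  - by rewrite big1 // => j _; rewrite /tp_opp; lia.
  - rewrite (eq_bigr (fun j : 'I_n => (2 * p + m <= j : nat)%N)) => [|j _].
      by rewrite sum_nat_geq; lia.
    by rewrite /tp_opp; lia.
by rewrite (eq_bigr _ (fun i _ => rowE i)) sum_nat_blocks; lia.
Qed.

Lemma card_same : #|[pred ij : 'I_n * 'I_n | tp_same p m ij.1 ij.2]| = (2 * p + m + r ^ 2)%N.
Proof.
rewrite (card_pair_pred (fun i j => tp_same p m i j)).
have rowE (i : 'I_n) : (\sum_(j < n) tp_same p m i j)%N =
    ((if i < 2 * p then 1 else if i < 2 * p + m then 0 else r) +
     (if i < 2 * p then 0 else if i < 2 * p + m then 1 else 0))%N.
  case: (ltnP i (2 * p + m)) => i2.
    rewrite (bigD1 i) //= big1 ?addn0 => [|j]; last first.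
      by rewrite -val_eqE /tp_same /=; lia.
    by rewrite /tp_same eqxx /=; case: ifP.
  rewrite (eq_bigr (fun j : 'I_n => (2 * p + m <= j : nat)%N)) => [|j _].
    by rewrite sum_nat_geq ifF ?ifF; lia.
  by rewrite /tp_same; lia.
rewrite (eq_bigr _ (fun i _ => rowE i)) big_split /= sum_nat_blocks.
suff -> : (\sum_(i < n) (if i < 2 * p then 0 else if i < 2 * p + m then 1 else 0)
  = m)%N by lia.
have E : (\sum_(i < n) ((if i < 2 * p then 0 else if i < 2 * p + m then 1 else 0) +
    ((2 * p + m <= i) : nat)))%N = (\sum_(i < n) (2 * p <= i : nat))%N.
  by apply: eq_bigr => i _; case: ltnP; case: ltnP; lia.
by move: E; rewrite big_split /= !sum_nat_geq; lia.
Qed.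

Definition slice_B : seq pidx :=
  [seq inl ij | ij <- enum [pred ij : 'I_n * 'I_n | tp_opp p m ij.1 ij.2]].
Definition slice_g : seq pidx :=
  [seq inr (inl ij) | ij <- enum [pred ij : 'I_n * 'I_n | ~~ tp_same p m ij.1 ij.2]].
Definition slice_a : seq pidx := [seq inr (inr k) | k <- iota 0 (p + m)].
(** The entries of g on the [tp_same] pattern, which describes the centralizer of A0, are left out
    and stay those of the identity. *)
Definition slice : seq pidx := slice_B ++ slice_g ++ slice_a.

(** The count is (2p + r^2) + (n^2 - (2p + m + r^2)) + (p + m). *)
Lemma size_slice : size slice = (n ^ 2 + p)%N.
Proof.
rewrite !size_cat !size_map -!cardE size_iota card_opp.
have := cardC [pred ij : 'I_n * 'I_n | tp_same p m ij.1 ij.2].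
rewrite card_same card_prod !card_ord.
rewrite (eq_card (B := [pred ij : 'I_n * 'I_n | ~~ tp_same p m ij.1 ij.2])) //.
by move: #|_| => c; lia.
Qed.

Lemma uniq_slice : uniq slice.
Proof.
rewrite !cat_uniq; apply/and3P; split.
- by rewrite map_inj_uniq ?enum_uniq // => ? ? [].
- apply/hasPn => z; rewrite mem_cat; case/orP=> /mapP[y _ ->]; apply/mapP; by case.
apply/and3P; split.
- by rewrite map_inj_uniq ?enum_uniq // => ? ? [].
- by apply/hasPn => z /mapP[y _ ->]; apply/mapP; case.
- by rewrite map_inj_uniq ?iota_uniq // => ? ? [].
Qed.

Lemma mem_slice_B i j : (inl (i, j) \in slice) = tp_opp p m i j.
Proof.
rewrite !mem_cat mem_map => [|? ? [] //]; rewrite mem_enum inE /=.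
by case: tp_opp => //=; apply/orP; case=> /mapP[].
Qed.

Lemma mem_slice_g i j : (inr (inl (i, j)) \in slice) = ~~ tp_same p m i j.
Proof.
rewrite !mem_cat [X in _ || (X || _)]mem_map => [|? ? [] //]; rewrite mem_enum inE /=.
by case: tp_same => /=; rewrite ?orbT //; apply/orP; case=> [/mapP[]|/mapP[]].
Qed.

Lemma mem_slice_a k : (inr (inr k) \in slice) = (k < p + m)%N.
Proof.
rewrite !mem_cat [X in _ || (_ || X)]mem_map => [|? ? [] //]; rewrite mem_iota /= add0n.
by case: ltnP => _; rewrite ?orbT //; apply/orP; case=> [/mapP[]|]; rewrite ?orbF => // /mapP[].
Qed.

(* The flag frees the entries of B first, then those of g, then a. *)
Lemma slice_order k z z' : (k < size slice)%N -> z = nth z slice k -> z' \in take k slice ->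
  match z with
  | inl _ => if z' is inl _ then True else False
  | inr (inl _) => if z' is inr (inr _) then False else True
  | inr (inr _) => True end.
Proof.
clear dim_eq; rewrite /slice !size_cat => ks; rewrite nth_cat take_cat.
case: ltnP => kB.
  case/mapP: (mem_nth z kB) => ij _ -> -> /mem_take.
  by case/mapP=> ? _ ->.
rewrite nth_cat take_cat mem_cat; case: ltnP => kg.
  case/mapP: (mem_nth z kg) => ij _ -> -> /orP[/mapP[? _ ->] //|/mem_take].
  by case/mapP=> ? _ ->.
have ka : (k - size slice_B - size slice_g < size slice_a)%N by lia.
by case/mapP: (mem_nth z ka) => ij _ -> ->.
Qed.

End Slice.

(** * Polynomials separating consecutive members of the flag *)

Section Flag.
Variables (K : numClosedFieldType) (n' p m r : nat).
Local Notation n := n'.+1.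
Hypothesis dim_eq : (2 * p + m + r = n)%N.
Local Notation pidx := (pidx n').
Local Notation slice := (slice n' p m).
Local Notation par_family := (@par_family K n' p m).
Local Notation par_pair := (@par_pair K n' p m).
Local Notation par0 := (@par0 K n').
Implicit Types (t : pidx -> K) (J : pred pidx).

Definition setp t (z : pidx) (c : K) : pidx -> K := fun z' => if z' == z then c else t z'.

Lemma par_g_invmx1 t : par_g t = 1%:M ->
  par_pair t = (dmx n' p m (par_a t), par_B p m t).
Proof. by move=> g1; rewrite /par_pair g1 invmx1 !mul1mx !mulmx1. Qed.

Lemma conj_sub_scalar (g A : 'M[K]_n) c : g \in unitmx ->
  g *m A *m invmx g - c%:M = g *m (A - c%:M) *m invmx g.
Proof.
move=> ug; rewrite mulmxBr mulmxBl; congr (_ - _).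
by rewrite -scalemx1 -!scalemxAr mulmx1 -scalemxAl mulmxV.
Qed.

Lemma det_conj (g A : 'M[K]_n) : g \in unitmx -> \det (g *m A *m invmx g) = \det A.
Proof.
by move=> ug; rewrite !det_mulmx mulrAC -det_mulmx mulmxV // det1 mul1r.
Qed.

Lemma flag_step_B (i j : 'I_n) J : (forall z, J z -> if z is inl _ then True else False) ->
  ~~ J (inl (i, j)) -> tp_opp p m i j ->
  [/\ polyfun (fun x : mxpair K n => x.2 i j),
      forall x, par_family J x -> x.2 i j = 0 &
      exists2 x, par_family (fun z => (z == inl (i, j)) || J z) x & x.2 i j != 0].
Proof.
move=> JB nJ oij; split; first exact: pf_coord2.
  move=> _ [t [tJ _ ->]]; rewrite par_g_invmx1 /= ?mxE ?oij ?tJ //.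
  apply/matrixP=> k l; rewrite !mxE tJ //; by apply/negP => /JB.
pose t := setp par0 (inl (i, j)) 1.
have gt : par_g t = 1%:M by apply/matrixP=> k l; rewrite !mxE.
exists (par_pair t).
  exists t; split=> // [z|]; first by rewrite negb_or /t /setp => /andP[/negPf->].
  by rewrite /par_ok gt det1 mul1r; apply/good_discP; apply: good_params_succ.
by rewrite par_g_invmx1 //= mxE oij /t /setp eqxx oner_eq0.
Qed.

(** While a_k is frozen at k + 1, that number is an eigenvalue of A. *)
Lemma flag_step_a k J : (k < p + m)%N -> ~~ J (inr (inr k)) ->
  [/\ polyfun (fun x : mxpair K n => \det (x.1 - k.+1%:R%:M)),
      forall x, par_family J x -> \det (x.1 - k.+1%:R%:M) = 0 &
      exists2 x, par_family (fun z => (z == inr (inr k)) || J z) x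
               & \det (x.1 - k.+1%:R%:M) != 0].
Proof.
move=> kpm nJ.
have detE a : \det (dmx n' p m a - k.+1%:R%:M : 'M[K]_n) =
    \prod_(i < n) (tp_diag p m a i - k.+1%:R).
  rewrite (_ : _ - _ = diag_mx (\row_(i < n) (tp_diag p m a i - k.+1%:R))).
    by rewrite det_diag; apply: eq_bigr => i _; rewrite mxE.
  by apply/matrixP=> i j; rewrite !mxE -mulrnBl.
split.
- have PA := polyfun_falg K n; apply: falg_det => //.
  by apply: mxfalgB => //; [apply: polyfun_mx1 | apply: mxfalgC].
- move=> _ [t [tJ /par_ok_split[ug ga] ->]] /=.
  rewrite conj_sub_scalar // det_conj // detE; apply/eqP/prodf_eq0.
  have [q [qn qs qsgn qidx]] : exists q, [/\ (q < n)%N, (q < 2 * p + m)%N,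
      tp_sgn p q = false & tp_idx p q = k].
    exists (if k < p then 2 * k else p + k)%N; rewrite /tp_sgn /tp_idx.
    by case: (ltnP k p) => kp; split; try lia; case: ltnP; lia.
  exists (Ordinal qn) => //; rewrite tp_diagE [nat_of_ord _]/= qs qsgn qidx.
  by rewrite mul1r /par_a tJ //= subrr.
(* This value exceeds all the other a_l with l < p + m, so the parameters stay good and k + 1 is no
   longer an eigenvalue. *)
pose t := setp par0 (inr (inr k)) (p + m).+1%:R.
have gt : par_g t = 1%:M by apply/matrixP=> i j; rewrite !mxE.
have aE l : par_a t l = (if l == k then p + m else l).+1%:R.
  rewrite /par_a /t /setp (_ : (inr (inr l) == inr (inr k) :> pidx) = (l == k)) //.
  by case: eqP.
have ga : good_params p m (par_a t).
  split=> [i _|i j il jl ij]; first by rewrite aE pnatr_eq0.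
  rewrite !aE -addr_eq0 -natrD pnatr_eq0 eqr_nat; split=> //.
  by move: ij; case: (eqVneq i k); case: (eqVneq j k); lia.
exists (par_pair t).
  exists t; split=> // [z|]; first by rewrite negb_or /t /setp => /andP[/negPf->].
  by rewrite /par_ok gt det1 mul1r; apply/good_discP.
rewrite par_g_invmx1 //= detE; apply/prodf_neq0 => i _.
rewrite tp_diagE; case: ifP => il; last by rewrite sub0r oppr_eq0 pnatr_eq0.
have := tp_idx_lt il; rewrite aE; case: tp_sgn => /= lt.
  by rewrite mulN1r -opprD oppr_eq0 -natrD pnatr_eq0.
by rewrite mul1r subr_eq0 eqr_nat; case: (tp_idx p i =P k); lia.
Qed.

(** As the eigenvalues of A are still frozen, a fixed polynomial in A is the spectral projection g E
    g^-1, with E the coordinate projection on the class of j. From it the entry (i, j) of g is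
    recovered up to the factor [\det (W x)]. *)
Lemma flag_step_g (i j : 'I_n) J : (forall z, J z -> if z is inr (inr _) then False else True) ->
  (forall k l : 'I_n, tp_same p m k l -> ~~ J (inr (inl (k, l)))) ->
  ~~ J (inr (inl (i, j))) -> ~~ tp_same p m i j ->
  exists f, [/\ polyfun f, forall x, par_family J x -> f x = 0 &
    exists2 x, par_family (fun z => (z == inr (inl (i, j))) || J z) x & f x != 0].
Proof.
move=> Ja Jsame nJ nij.
have ga := @good_params_succ K p m.
pose d (k : nat) : K := tp_diag p m (fun k => k.+1%:R) k.
have dE k l : (d k == d l) = tp_same p m k l := tp_diag_eq dim_eq k l ga.
(* Lagrange interpolation: [pi] is 1 at the eigenvalue [d j] and 0 at the other ones. *)
pose pi0 : {poly K} := \prod_(k < n | ~~ tp_same p m k j) ('X - (d k)%:P).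
pose pi := (pi0.[d j])^-1 *: pi0.
pose E : 'M[K]_n := diag_mx (\row_k (tp_same p m k j)%:R).
have pi0j : pi0.[d j] != 0.
  rewrite horner_prod; apply/prodf_neq0 => k.
  by rewrite !hornerE subr_eq0 eq_sym dE.
have piE (k : 'I_n) : pi.[d k] = (tp_same p m k j)%:R.
  rewrite hornerZ; case: (boolP (tp_same p m k j)) => kj.
    by have /eqP -> : d k == d j; [rewrite dE | rewrite mulVf].
  suff -> : pi0.[d k] = 0 by rewrite mulr0.
  by rewrite horner_prod (bigD1 k) //= !hornerE subrr mul0r.
have EE : E *m E = E.
  by rewrite mulmx_diag; congr diag_mx; apply/rowP=> k; rewrite !mxE -natrM mulnb andbb.
pose Y (x : mxpair K n) := horner_mx x.1 pi.
pose W x := E *m Y x *m E + (1%:M - E).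
pose f x := (Y x *m E *m \adj (W x)) i j.
have PA := polyfun_falg K n.
have PY : mxfalg (@polyfun K n) Y by apply: mxfalg_horner => //; apply: polyfun_mx1.
have PC (A : 'M_n) : mxfalg (@polyfun K n) (fun=> A) by apply: mxfalgC.
have PYE : mxfalg (@polyfun K n) (fun x => Y x *m E) by apply: mxfalgM.
have Pf : polyfun f.
  apply: mxfalgM => //; apply: mxfalg_adj => //; apply: mxfalgD => //.
  by apply: mxfalgM => //; apply: mxfalgM.
have YE t : par_g t \in unitmx -> (forall k, (k < p + m)%N -> par_a t k = k.+1%:R) ->
    Y (par_pair t) = par_g t *m E *m invmx (par_g t).
  move=> ug at_; rewrite /Y /= horner_mx_uconj // horner_mx_diag; congr (_ *m _ *m _).
  congr diag_mx; apply/rowP=> k; rewrite !mxE -piE; congr (pi.[_]).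
  rewrite /d !tp_diagE; case: ifP => // kl; congr (_ * _); apply: at_.
  exact: (tp_idx_lt).
have EgE (g : 'M[K]_n) : (forall k l : 'I_n, tp_same p m k l -> g k l = (k == l)%:R) ->
    E *m g *m E = E.
  move=> gs; apply/matrixP=> k l; rewrite mul_diag_mx mul_mx_diag !mxE.
  case: (boolP (tp_same p m k j)) => kj; last by rewrite !mul0r mul0rn.
  case: (boolP (tp_same p m l j)) => lj; last first.
    rewrite mulr0; case: eqP => // kl; by rewrite -kl kj in lj.
  by rewrite mul1r mulr1 gs //; move: kj lj; rewrite /tp_same; lia.
(* Since E g E = E, one has g E W = Y E; multiplying by the adjugate of W gives g E times the
   determinant of W, and column j of g E is that of g. *)
have gEW t : par_g t \in unitmx -> (forall k, (k < p + m)%N -> par_a t k = k.+1%:R) ->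
    (forall k l : 'I_n, tp_same p m k l -> par_g t k l = (k == l)%:R) ->
    f (par_pair t) = par_g t i j * \det (W (par_pair t)).
  move=> ug at_ gs; have gEW : par_g t *m E *m W (par_pair t) = Y (par_pair t) *m E.
    rewrite /W YE // mulmxDr mulmxBr mulmx1 -[_ *m E *m E]mulmxA EE subrr addr0.
    by rewrite !mulmxA -[_ *m E *m E]mulmxA EE -[par_g t *m E *m _ *m E]mulmxA
      -!(mulmxA (par_g t)) (mulmxA E) EgE // !mulmxA.
  rewrite /f -gEW -(mulmxA _ (W _)) mul_mx_adj mul_mx_scalar mul_mx_diag !mxE.
  by rewrite /tp_same eqxx mulr1 mulrC.
have ij : (i == j) = false by apply: contraNF nij => /eqP->; rewrite /tp_same eqxx.
exists f; split=> //.
  move=> _ [t [tJ /par_ok_split[ug _] ->]]; rewrite gEW //.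
  - by rewrite mxE tJ //= ij mul0r.
  - by move=> k _; rewrite /par_a tJ //; apply/negP => /Ja.
  - by move=> k l kl; rewrite mxE tJ //; apply: Jsame.
pose t := setp par0 (inr (inl (i, j))) 1.
have gt : par_g t = 1%:M + delta_mx i j.
  apply/matrixP=> k l; rewrite !mxE /t /setp.
  rewrite (_ : (inr (inl (k, l)) == inr (inl (i, j)) :> pidx) = (k == i) && (l == j)) //.
  case e: ((k == i) && (l == j)); last by rewrite addr0.
  by have /andP[/eqP-> /eqP->] := e; rewrite ij add0r.
have dd : delta_mx i j *m delta_mx i j = 0 :> 'M[K]_n.
  by rewrite mul_delta_mx_0 // eq_sym ij.
have g1 : par_g t *m (1%:M - delta_mx i j) = 1%:M.
  by rewrite gt mulmxBr mulmx1 mulmxDl mul1mx dd addr0 addrK.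
have [ug _] := mulmx1_unit g1.
have gV : invmx (par_g t) = 1%:M - delta_mx i j.
  by have := congr1 (mulmx (invmx (par_g t))) g1; rewrite mulKmx // mulmx1 => ->.
have Ed : E *m delta_mx i j = 0.
  rewrite mul_diag_mx; apply/matrixP=> k l; rewrite !mxE.
  by case: eqVneq => [->|_] /=; rewrite ?mulr0 // (negPf nij) mul0r.
have W1 : W (par_pair t) = 1%:M.
  rewrite /W YE // !mulmxA EgE => [|k l kl]; last first.
    rewrite gt !mxE (_ : (k == i) && (l == j) = false) ?addr0 //.
    by apply: contraNF nij => /andP[/eqP<- /eqP<-].
  by rewrite gV mulmxBr mulmxBl mulmx1 EE Ed mul0mx subr0 addrC subrK.
exists (par_pair t).
  exists t; split=> // [z|]; first by rewrite negb_or /t /setp => /andP[/negPf->].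
  rewrite mulf_neq0 //; first by rewrite -unitfE -unitmxE.
  by apply/good_discP.
rewrite gEW // ?W1 ?det1 ?mulr1 => [|k l kl].
  by rewrite gt !mxE !eqxx ij add0r oner_neq0.
rewrite gt !mxE (_ : (k == i) && (l == j) = false) ?addr0 //.
by apply: contraNF nij => /andP[/eqP<- /eqP<-].
Qed.

End Flag.

(** * Dimension of the strata *)

Section Dimension.
Variables (K : numClosedFieldType) (n' p m r : nat).
Local Notation n := n'.+1.
Hypothesis dim_eq : (2 * p + m + r = n)%N.
Local Notation pidx := (pidx n').
Local Notation slice := (slice n' p m).
Local Notation par_family := (@par_family K n' p m).
Local Notation par_pair := (@par_pair K n' p m).
Local Notation par_pair_adj := (@par_pair_adj K n' p m).
Local Notation par0 := (@par0 K n').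
Local Notation par_ok := (@par_ok K n' p m).
Implicit Types (t : pidx -> K) (J : pred pidx).

Definition flag k : pset K n := par_family (fun z => z \in take k slice).

Lemma flag_step k : (k < size slice)%N ->
  exists f, [/\ polyfun f, forall x, flag k x -> f x = 0 &
    exists2 x, flag k.+1 x & f x != 0].
Proof.
move=> ks; pose z0 : pidx := inr (inr 0); set z := nth z0 slice k.
have zE : z = nth z slice k by apply: set_nth_default.
have zk : z \notin take k slice.
  have := take_uniq k.+1 (uniq_slice n' p m).
  by rewrite (take_nth z0 ks) rcons_uniq => /andP[].
have zs : z \in slice by apply: mem_nth.
have flagS : flag k.+1 = par_family (fun y => (y == z) || (y \in take k slice)).
  by congr par_family; apply/funext=> y; rewrite (take_nth z0 ks) mem_rcons inE.
have ord z' := @slice_order n' p m k z z' ks zE; rewrite flagS {flagS zE}.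
case: z zk zs ord => [[i j]|[[i j]|l]] zk zs ord.
- have [] := @flag_step_B K n' p m i j (fun y => y \in take k slice) => //.
    by rewrite -mem_slice_B.
  by move=> *; exists (fun x : mxpair K n => x.2 i j).
- apply: (@flag_step_g K n' p m r dim_eq i j (fun y => y \in take k slice)) => //; last by rewrite -mem_slice_g.
  move=> a b sab; apply: contraL sab => /mem_take.
  by rewrite mem_slice_g.
- have [] := @flag_step_a K n' p m r dim_eq l (fun y => y \in take k slice) => //.
    by rewrite mem_slice_a in zs.
  by move=> *; exists (fun x : mxpair K n => \det (x.1 - l.+1%:R%:M)).
Qed.

Lemma par_family_mono J J' : (forall z, J z -> J' z) ->
  psubset (par_family J) (par_family J').
Proof.
move=> JJ' _ [t [tJ tok ->]]; exists t; split=> // z nJ'; apply: tJ.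
by apply: contra nJ'; apply: JJ'.
Qed.

Lemma sub_Zcirc J : psubset (par_family J) (Zcirc K n p m r).
Proof. by move=> x Fx; apply/(ZcircP dim_eq); apply: par_family_mono Fx. Qed.

Lemma Zpmr_chain : exists c, irr_chain (Zpmr K n p m r) (n ^ 2 + p) c.
Proof.
exists (fun k => zclosure (flag k)); rewrite -(size_slice dim_eq); split=> [k _|k ks|].
- exact: zirreducible_par_family.
- split=> [|sub].
    apply: zclosure_mono; apply: par_family_mono => z.
    by move=> zk; rewrite (take_nth z ks) mem_rcons inE zk orbT.
  have [f [pf f0 [x Fx /eqP]]] := flag_step ks; apply.
  by have /zclosureP/(_ f pf) := sub x (sub_zclosure Fx); apply.
- by apply: zclosure_mono; apply: sub_Zcirc.
Qed.

(** * Upper bound for the length of chains *)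

Section UpperBound.
Local Notation N := (size slice).

Definition emb (u : {ffun 'I_N -> K}) : pidx -> K :=
  fun z => oapp u (par0 z) (insub (index z slice)).

Lemma emb_surj t : (forall z, z \notin slice -> t z = par0 z) -> exists u, emb u = t.
Proof.
move=> t0; exists [ffun k : 'I_N => t (nth (inr (inr 0)) slice k)]; apply/funext=> z.
rewrite /emb; case: insubP => [k _ kz|] /=.
  by rewrite ffunE kz nth_index // -index_mem -kz ltn_ord.
by rewrite index_mem => /t0.
Qed.

Lemma pbounded_emb z : pbounded (fun u => emb u z).
Proof.
rewrite /emb; case: insub => [k|] /=; first exact: pbounded_coord.
exact: (falgC (pbounded_falg K N)).
Qed.

(** Projection of g to the centralizer of A0; where it is invertible it can be divided out on the
    right. *)
Definition blk (g : 'M[K]_n) : 'M[K]_n := \matrix_(i, j) if tp_same p m i j then g i j else 0.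

Lemma tp_diag_scale c (a : nat -> K) i :
  tp_diag p m (fun k => c * a k) i = c * tp_diag p m a i.
Proof. by rewrite /tp_diag; case: ifP => _; case: ifP => _; rewrite ?mulrN ?mulr0. Qed.

(* Modulo the stabilizer of A0, a generic g is normalized to the slice. *)
Lemma par_pair_normalize t : par_ok t != 0 -> \det (blk (par_g t)) != 0 ->
  exists u, par_pair t = par_pair_adj (emb u).
Proof.
move=> /par_ok_split[ug ga] hd; set g := par_g t in ug hd *; set h := blk g in hd *.
set D := dmx n' p m (par_a t); set B := par_B p m t.
have uh : h \in unitmx by rewrite unitmxE unitfE.
have hD : h *m D = D *m h.
  by apply/(comm_dmx dim_eq) => // i j /negPf nij; rewrite mxE nij.
have hVD : invmx h *m D = D *m invmx h.
  by apply: (can_inj (mulKmx uh)); rewrite !mulmxA mulmxV // mul1mx hD mulmxK.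
have /(comm_dmx dim_eq _ ga) hV0 := hVD.
pose g' := g *m invmx h; pose B' := h *m B *m invmx h.
have ug' : g' \in unitmx by rewrite unitmx_mul ug unitmx_inv.
have g'V : invmx g' = h *m invmx g.
  apply: (can_inj (mulKmx ug')); rewrite mulmxV // /g' mulmxA mulmxKV //.
  by rewrite mulmxV.
have dg' : \det g' != 0 by rewrite -unitfE -unitmxE.
(* The inverse of h has the block pattern too, so on that pattern the product g h^-1 sees only h. *)
have g'same (i j : 'I_n) : tp_same p m i j -> g' i j = (i == j)%:R.
  move=> sij; have := mulmxV uh => /matrixP/(_ i j); rewrite [RHS]mxE => <-.
  rewrite [LHS]mxE [RHS]mxE; apply: eq_bigr => k _.
  case: (boolP (tp_same p m k j)) => [skj|/hV0->]; last by rewrite !mulr0.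
  congr (_ * _); rewrite [RHS]mxE ifT //.
  by move: sij skj; rewrite /tp_same; lia.
have gD : g *m D *m invmx g = g' *m D *m invmx g'.
  rewrite g'V /g' -!mulmxA; congr (_ *m _); rewrite !mulmxA hVD.
  by rewrite mulmxKV.
have gB : g *m B *m invmx g = g' *m B' *m invmx g'.
  by rewrite g'V /g' /B' !mulmxA !mulmxKV.
have DB' : D *m B' + B' *m D = 0.
  rewrite /B' -!mulmxA hVD !mulmxA -hD -!mulmxA -mulmxDr !mulmxA -mulmxDl.
  by rewrite (par_B_anticomm dim_eq) // mul0mx mulmx0.
have /(anticomm_dmxP dim_eq _ ga) B'0 := DB'.
(* Scaling a and B by [dV] compensates the factor [\det g'] that the adjugate introduces. *)
pose dV := (\det g')^-1.
pose t' (z : pidx) := match z with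
  | inl (i, j) => if tp_opp p m i j then dV * B' i j else 0
  | inr (inl (i, j)) => g' i j
  | inr (inr k) => if (k < p + m)%N then dV * par_a t k else par0 z end.
have [u uE] : exists u, emb u = t'.
  apply: emb_surj => -[[i j]|[[i j]|k]] /=.
  - by rewrite mem_slice_B => /negPf->.
  - by rewrite mem_slice_g negbK => /g'same.
  - by rewrite mem_slice_a => /negPf->.
exists u; rewrite uE /par_pair_adj.
have -> : par_g t' = g' by apply/matrixP=> i j; rewrite mxE.
have -> : par_B p m t' = dV *: B'.
  apply/matrixP=> i j; rewrite [LHS]mxE [RHS]mxE /=.
  by case oij: (tp_opp p m i j) => //; rewrite B'0 ?mulr0 ?oij.
have -> : dmx n' p m (par_a t') = dV *: D.
  apply/matrixP=> i j; rewrite !mxE mulrnAr -tp_diag_scale !tp_diagE.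
  by case: ifP => // il; rewrite /par_a /= tp_idx_lt.
rewrite /par_pair -/g -/D -/B gD gB /invmx ug' -/dV.
by rewrite -!scalemxAr -!scalemxAl.
Qed.

(** Normalization requires an invertible block part of g. On the line from g to the identity this
    holds generically, and the vanishing extends to the starting point. *)
Lemma polyfun_slice0 (q : mxpair K n -> K) : polyfun q ->
  (forall u, q (par_pair_adj (emb u)) = 0) -> forall x, Zpmr K n p m r x -> q x = 0.
Proof.
move=> pq q0; apply: zclosure_min; first exact: zclosed_polyfun0.
move=> _ /(ZcircP dim_eq)[t [_ tok ->]].
pose L s (z : pidx) := if z is inr (inl (i, j))
  then (1 - s) * t z + s * (i == j)%:R else t z.
have UA := upoly_falg K.
have UL z : upoly (fun s => L s z).
  case: z => [z|[[i j]|z]]; [exact: falgC | | exact: falgC].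
  apply: falgD => //; apply: falgM => //; try exact: falgC; last exact: upoly_id.
  by apply: falgB => //; [apply: falgC | apply: upoly_id].
have L0 : L 0 = t.
  by apply/funext=> -[z|[[i j]|z]] //=; rewrite subr0 mul1r mul0r addr0.
have g1 : par_g (L 1) = 1%:M.
  by apply/matrixP=> i j; rewrite !mxE /= subrr mul0r mul1r add0r.
have Ublk : upoly (fun s => \det (blk (par_g (L s)))).
  apply: falg_det => // i j; case sij: (tp_same p m i j).
    by apply: falg_ext (UL (inr (inl (i, j)))) => s; rewrite !mxE sij.
  by apply: falg_ext (falgC UA 0) => s; rewrite mxE sij.
have blk1 : \det (blk (par_g (L 1))) != 0.
  rewrite g1 (_ : blk _ = 1%:M) ?det1 ?oner_eq0 //; apply/matrixP=> i j.
  rewrite !mxE; case: (eqVneq i j) => [->|_]; first by rewrite /tp_same eqxx.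
  by case: ifP.
have Uok := falg_par_ok p m UA UL.
have ok0 : par_ok (L 0) != 0 by rewrite L0.
have [s2 /andP[bs2 oks2]] := upoly_neq0M Ublk Uok blk1 ok0.
have Ud : upoly (fun s => \det (par_g (L s))) by apply: falg_det => //; apply: falg_par_g.
have dN0 t' : par_ok t' != 0 -> \det (par_g t') != 0.
  by case/par_ok_split; rewrite unitmxE unitfE.
have [F UF [M FE]] :=
  falg_polyfun_rat UA Ud (falg_par_adj1 p m UA UL) (falg_par_adj2 p m UA UL) pq.
have F0 s : F s = 0.
  apply: (upoly_generic0 UF (falgM UA Ublk Uok) (mulf_neq0 bs2 oks2)) => {}s.
  rewrite mulf_eq0 negb_or => /andP[bs oks]; have ds := dN0 _ oks.
  rewrite FE // -par_pairE //.
  by have [u ->] := par_pair_normalize oks bs; rewrite q0 mulr0.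
have := F0 0; rewrite FE L0 ?dN0 // -par_pairE ?dN0 // => /eqP.
by rewrite mulf_eq0 expf_eq0 (negPf (dN0 _ tok)) andbF => /eqP.
Qed.

(** With N the size of the slice, such a chain yields N + 1 polynomials, each zero on one member and
    not on the next. Pulled back to the slice they are dependent, the relation extends to the
    closure, and [chain_independent] kills its coefficients. *)
Lemma Zpmr_no_long_chain : ~ exists c, irr_chain (Zpmr K n p m r) (n ^ 2 + p).+1 c.
Proof.
rewrite -(size_slice dim_eq) => -[c [irr strict cZ]].
have step k : {f | [/\ polyfun f, (k < N.+1)%N -> forall x, c k x -> f x = 0 &
    (k < N.+1)%N -> exists2 x, c k.+1 x & f x != 0]}.
  apply: cid; have [kN|_] := ltnP k N.+1; last first.
    by exists (fun=> 0); split=> //; apply: pf_const.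
  have [sub nsub] := strict k kN; have [[F [pF cF]] _ _] := irr k (ltnW kN).
  apply: contrapT => nex; apply: nsub => x cx; apply/cF => f Ff; apply: contrapT => fx.
  apply: nex; exists f; split=> [|_ y /cF|_]; [exact: pF | exact | ].
  by exists x => //; apply/eqP.
pose f k := sval (step k).
have pf k : polyfun (f k) by rewrite /f; case: (step k) => ? [].
have pb k : pbounded (fun u => f k (par_pair_adj (emb u))).
  have PA := pbounded_falg K N.
  have := falg_polyfun PA (falg_par_adj1 p m PA pbounded_emb) (falg_par_adj2 p m PA pbounded_emb).
  by apply.
have [M [a [[e ae] rel]]] := algebraic_dependence pb.
move/eqP: ae; apply; apply: (@chain_independent K n c f M N.+1 a) => //.
- by move=> k kN; have [] := strict k kN.
- by move=> k x kN; case: (svalP (step k)) => _ /(_ kN x).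
- by move=> k kN; case: (svalP (step k)) => _ _ /(_ kN).
move=> x /cZ; apply: (polyfun_slice0 (q := fun x => \sum_e a e * monom f e x)).
  have PA := polyfun_falg K n; apply: falg_sum => // e' _.
  by apply: falgM => //; [apply: falgC | apply: falg_monom].
move=> u; rewrite -[RHS](rel u); apply: eq_bigr => e' _.
by rewrite (monom_comp f (fun u => par_pair_adj (emb u))).
Qed.

End UpperBound.

Lemma zdim_Zpmr : zdim (Zpmr K n p m r) (n ^ 2 + p).
Proof. by split; [exact: Zpmr_chain | exact: Zpmr_no_long_chain]. Qed.

End Dimension.

(** * Separating the strata by traces *)

Section Hankel.
Variable K : numClosedFieldType.

Definition hankel k (tau : nat -> K) : 'M[K]_k := \matrix_(i, j) tau (i + j)%N.

Lemma horner_mx_coefs n (M : 'M[K]_n.+1) (q : {poly K}) :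
  horner_mx M q = \sum_(i < size q) q`_i *: M ^+ i.
Proof.
rewrite -[q in LHS]coefK poly_def linear_sum; apply: eq_bigr => i _.
by rewrite linearZ rmorphXn /= horner_mx_X.
Qed.

(** By Cayley-Hamilton, tau satisfies a linear recurrence of order rho; the coefficients of the
    characteristic polynomial of M form a kernel vector. *)
Lemma det_hankel_trace rho k (N M : 'M[K]_rho) tau : (rho < k)%N ->
  (forall s, tau s = \tr (N *m M ^+ s)) -> \det (hankel k tau) = 0.
Proof.
case: rho N M => [|rho] N M rk tauE.
  case: k rk => // k _; rewrite (_ : hankel _ _ = 0) ?det0 //.
  by apply/matrixP=> i j; rewrite !mxE tauE /mxtrace big_ord0.
apply/eqP/det0P; pose c := char_poly M.
have cs : size c = rho.+2 by apply: size_char_poly.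
exists (\row_(i < k) c`_i).
  apply/rV0Pn; exists (Ordinal rk); rewrite mxE /=.
  have : lead_coef c = 1 by apply/monicP/char_poly_monic.
  by rewrite lead_coefE cs /= => ->; apply: oner_neq0.
apply/rowP=> j; rewrite !mxE.
transitivity (\tr (N *m (horner_mx M c *m M ^+ j))); last first.
  by rewrite Cayley_Hamilton mul0mx mulmx0 mxtrace0.
rewrite horner_mx_coefs cs (big_ord_widen k (fun i => c`_i *: M ^+ i)) //.
rewrite mulmx_suml mulmx_sumr raddf_sum /= [RHS]big_mkcond /=.
apply: eq_bigr => i _; rewrite !mxE tauE; case: ltnP => [_|ci].
  by rewrite -scalemxAl -scalemxAr mxtraceZ exprD.
by rewrite nth_default ?mul0r // cs.
Qed.

(** The matrix factors as V D V^T with V the Vandermonde matrix of the d_i and D the diagonal matrix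
    of the w_i. *)
Lemma det_hankel_sum k (w d : nat -> K) tau :
  (forall i, (i < k)%N -> w i != 0) ->
  (forall i j, (i < j < k)%N -> d i != d j) ->
  (forall s, tau s = \sum_(i < k) w i * d i ^+ s) -> \det (hankel k tau) != 0.
Proof.
move=> w0 dij tauE; pose V := Vandermonde k (\row_(i < k) d i).
have -> : hankel k tau = V *m diag_mx (\row_(i < k) w i) *m V^T.
  apply/matrixP=> i j; rewrite !mxE tauE; apply: eq_bigr => l _.
  by rewrite mul_mx_diag !mxE exprD; ring.
rewrite !det_mulmx det_tr det_diag det_Vandermonde; apply: mulf_neq0; [apply: mulf_neq0|].
- apply/prodf_neq0 => i _; apply/prodf_neq0 => j ij.
  by rewrite !mxE subr_eq0 eq_sym dij // ij ltn_ord.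
- by apply/prodf_neq0 => i _; rewrite mxE w0.
- apply/prodf_neq0 => i _; apply/prodf_neq0 => j ij.
  by rewrite !mxE subr_eq0 eq_sym dij // ij ltn_ord.
Qed.

(** Conjugation by D turns U into - U, so an odd power has the same trace as its opposite. *)
Lemma tr_odd_anticomm n (D U : 'M[K]_n) s : D \in unitmx -> D *m U + U *m D = 0 ->
  \tr (U ^+ (2 * s).+1) = 0.
Proof.
move=> uD /eqP; rewrite addr_eq0 => /eqP DU.
have DUk k : D *m U ^+ k = (-1) ^+ k *: (U ^+ k *m D).
  elim: k => [|k IHk]; first by rewrite !expr0 scale1r mulmx1 mul1mx.
  rewrite !exprS -!mulmxE mulmxA DU mulNmx -(mulmxA U D) IHk -scalemxAr mulmxA.
  by rewrite mulN1r scaleNr.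
have /eqP : \tr (U ^+ (2 * s).+1) = - \tr (U ^+ (2 * s).+1).
  rewrite -{1}[U ^+ _](mulKmx uD) DUk exprS exprM sqrrN !expr1n mulr1 scaleN1r.
  by rewrite mulmxN raddfN /= mxtrace_mulC mulmxK.
by rewrite -addr_eq0 -mulr2n mulrn_eq0 => /eqP.
Qed.

Lemma mxtrace_conj n (g A : 'M[K]_n) : g \in unitmx ->
  \tr (g *m A *m invmx g) = \tr A.
Proof. by move=> ug; rewrite mxtrace_mulC mulmxA mulVmx // mul1mx. Qed.

Lemma conj_exp n (g A : 'M[K]_n) k : g \in unitmx ->
  (g *m A *m invmx g) ^+ k = g *m A ^+ k *m invmx g.
Proof.
move=> ug; elim: k => [|k IHk]; first by rewrite !expr0 mulmx1 mulmxV.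
by rewrite !exprS IHk -!mulmxE !mulmxA mulmxKV.
Qed.

Lemma diag_mx_exp n (d : 'rV[K]_n) k : diag_mx d ^+ k = diag_mx (\row_i d 0 i ^+ k).
Proof.
elim: k => [|k IHk].
  by apply/matrixP=> i j; rewrite expr0 !mxE expr0.
rewrite exprS IHk -mulmxE mulmx_diag; congr diag_mx; apply/rowP=> i.
by rewrite !mxE exprS.
Qed.

Lemma block_diag_exp n1 n2 (A : 'M[K]_n1) (B : 'M[K]_n2) k :
  block_mx A 0 0 B ^+ k = block_mx (A ^+ k) 0 0 (B ^+ k).
Proof.
elim: k => [|k IHk]; first by rewrite !expr0 -scalar_mx_block.
by rewrite !exprS IHk -!mulmxE mulmx_block !mul0mx !mulmx0 !addr0 add0r.
Qed.

Lemma sum_double (p : nat) (F : nat -> K) :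
  \sum_(i < 2 * p) F i = \sum_(k < p) (F (2 * k)%N + F (2 * k).+1).
Proof.
elim: p => [|p IHp]; first by rewrite !big_ord0.
by rewrite mulnS !big_ord_recr /= IHp addrA.
Qed.

Section Traces.
Variables (n p m r : nat) (a : nat -> K) (A0 B0 : 'M[K]_n).
Hypotheses (dim_eq : (2 * p + m + r)%N = n) (ga : good_params p m a).
Hypotheses (A0E : A0 = diag_mx (\row_(i < n) tp_diag p m a i)) (AB0 : Zn K n (A0, B0)).

Lemma tr_odd_A s : \tr (A0 ^+ (2 * s).+1) =
  \sum_(k < m) a (p + k)%N * (a (p + k)%N ^+ 2) ^+ s.
Proof.
rewrite A0E diag_mx_exp mxtrace_diag; clear A0E AB0 A0 B0; subst n.
under eq_bigr => i _ do rewrite !mxE.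
rewrite -(big_mkord xpredT (fun i => tp_diag p m a i ^+ (2 * s).+1)).
rewrite (@big_cat_nat _ _ _ (2 * p + m)) /=; [|lia..].
rewrite (@big_cat_nat _ _ _ (2 * p)) /=; [|lia..].
rewrite big_mkord (sum_double p (fun i => tp_diag p m a i ^+ (2 * s).+1)) big1 ?add0r => [|k _]; last first.
  have kp := ltn_ord k.
  have -> : tp_diag p m a (2 * k) = a k.
    by rewrite /tp_diag ifT ?ifF; [congr a|..]; lia.
  have -> : tp_diag p m a (2 * k).+1 = - a k.
    by rewrite /tp_diag ifT ?ifT; [congr (- a _)|..]; lia.
  by rewrite !exprS !exprM sqrrN mulNr subrr.
have -> : \sum_(2 * p + m <= i < 2 * p + m + r) tp_diag p m a i ^+ (2 * s).+1 = 0.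
  rewrite big_nat; apply: big1 => k /andP[k1 _].
  by rewrite /tp_diag !ifF ?expr0n //; lia.
rewrite addr0.
rewrite -{1}[(2 * p)%N]add0n big_addn addKn big_mkord; apply: eq_bigr => k _.
have km := ltn_ord k; rewrite /tp_diag ifF ?ifT; [|lia..]; rewrite exprS exprM.
by have -> : (k + 2 * p - p = p + k)%N by lia.
Qed.

End Traces.

(** A0 is invertible on the first 2p + m coordinates and zero on the rest, which makes B0 block
    diagonal; its first block anticommutes with an invertible matrix. *)
Lemma tr_odd_B n p m r (a : nat -> K) (A0 B0 : 'M[K]_n)
    (dim_eq : (2 * p + m + r)%N = n) s :
  good_params p m a -> A0 = diag_mx (\row_(i < n) tp_diag p m a i) ->
  Zn K n (A0, B0) ->
  \tr (B0 ^+ (2 * s).+1) =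
  \tr ((\matrix_(i, j) B0 (cast_ord dim_eq (rshift (2 * p + m) i))
                          (cast_ord dim_eq (rshift (2 * p + m) j))) ^+ (2 * s).+1).
Proof.
move: A0 B0; case: _ / dim_eq => A0 B0 ga A0E.
set B1 : 'M_r := \matrix_(i, j) _.
have -> : B1 = drsubmx B0.
  by apply/matrixP=> i j; rewrite !mxE !cast_ord_id.
rewrite /Zn /= -[A0]submxK -[B0]submxK !mulmx_block add_block_mx.
set U := ulsubmx B0; set X := ursubmx B0; set Y := dlsubmx B0.
set D := ulsubmx A0; have -> : ursubmx A0 = 0.
  by apply/matrixP=> i j; rewrite A0E !mxE eq_lrshift mulr0n.
have -> : dlsubmx A0 = 0.
  by apply/matrixP=> i j; rewrite A0E !mxE eq_rlshift mulr0n.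
have -> : drsubmx A0 = 0.
  apply/matrixP=> i j; rewrite A0E !mxE /tp_diag !ifF ?mul0rn //=; lia.
have uD : D \in unitmx.
  have -> : D = diag_mx (\row_(i < 2 * p + m) tp_diag p m a i).
    by apply/matrixP=> i j; rewrite /D A0E !mxE eq_lshift.
  rewrite unitmxE det_diag unitfE; apply/prodf_neq0 => i _; rewrite mxE tp_diagE ltn_ord.
  rewrite mulf_neq0 ?signr_eq0 //; apply: ga.1; exact: tp_idx_lt (ltn_ord i).
rewrite !mul0mx !mulmx0 !addr0 !add0r => /eqP.
rewrite block_mx_eq0 => /and4P[/eqP DU /eqP DX /eqP YD _].
have X0 : X = 0 by rewrite -[X](mulKmx uD) DX mulmx0.
have Y0 : Y = 0 by rewrite -[Y](mulmxK uD) YD mul0mx.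
rewrite X0 Y0 block_diag_exp mxtrace_block (tr_odd_anticomm s uD DU) add0r.
by rewrite block_mxKdr.
Qed.

Lemma polyfun_hankel n k (tau : nat -> mxpair K n -> K) : (forall s, polyfun (tau s)) ->
  polyfun (fun x => \det (hankel k (fun s => tau s x))).
Proof.
move=> ptau; apply: (falg_det (polyfun_falg K n)) => i j.
by apply: falg_ext (ptau (i + j)%N) => x; rewrite mxE.
Qed.

Lemma trX_odd n (A : 'M[K]_n) s : \tr (A ^+ (2 * s).+1) = \tr (A *m (A ^+ 2) ^+ s).
Proof. by rewrite exprS exprM. Qed.

Section Separation.
Variables (n' p m r : nat).
Local Notation n := n'.+1.
Hypothesis dim_eq : (2 * p + m + r = n)%N.
Implicit Types x : mxpair K n.

Definition tr_odd1 s x := \tr (x.1 ^+ (2 * s).+1).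
Definition tr_odd2 s x := \tr (x.2 ^+ (2 * s).+1).

Lemma polyfun_tr_odd1 s : polyfun (tr_odd1 s).
Proof.
by apply: (falg_tr (polyfun_falg K n)); apply: (mxfalgX (polyfun_falg K n)); exact: polyfun_mx1.
Qed.

Lemma polyfun_tr_odd2 s : polyfun (tr_odd2 s).
Proof.
by apply: (falg_tr (polyfun_falg K n)); apply: (mxfalgX (polyfun_falg K n)); exact: polyfun_mx2.
Qed.

Lemma Zcirc_hankel1 k x : (m < k)%N -> Zcirc K n p m r x ->
  \det (hankel k (fun s => tr_odd1 s x)) = 0.
Proof.
move=> mk [e [g [A0 [B0 [a [ug ga A0E AB0 ->]]]]]].
apply: (@det_hankel_trace m k (diag_mx (\row_(i < m) a (p + i)%N))
  (diag_mx (\row_(i < m) a (p + i)%N ^+ 2))) => // s.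
rewrite /tr_odd1 /= conj_exp // mxtrace_conj // (tr_odd_A dim_eq A0E).
rewrite diag_mx_exp mulmx_diag mxtrace_diag; apply: eq_bigr => k' _.
by rewrite !mxE.
Qed.

Lemma Zcirc_hankel2 k x : (r < k)%N -> Zcirc K n p m r x ->
  \det (hankel k (fun s => tr_odd2 s x)) = 0.
Proof.
move=> rk [e [g [A0 [B0 [a [ug ga A0E AB0 ->]]]]]].
pose B1 : 'M_r := \matrix_(i, j) B0 (cast_ord dim_eq (rshift (2 * p + m) i))
                          (cast_ord dim_eq (rshift (2 * p + m) j)).
apply: (@det_hankel_trace r k B1 (B1 ^+ 2)) => // s.
by rewrite /tr_odd2 /= conj_exp // mxtrace_conj // (tr_odd_B dim_eq s ga A0E AB0) trX_odd.
Qed.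

(** An entry of A0 B0 is nonzero only between two partners below 2p, so the rank of the product is
    at most 2p. *)
Lemma Zcirc_det12 k x (P : 'M[K]_(k, n)) (Q : 'M_(n, k)) : (2 * p < k)%N ->
  Zcirc K n p m r x -> \det (P *m (x.1 *m x.2) *m Q) = 0.
Proof.
move=> pk [_ [g [A0 [B0 [a [ug ga A0E AB0 ->]]]]]] /=.
have AB : A0 *m B0 = A0 *m B0 *m pid_mx (2 * p) *m (pid_mx (2 * p) : 'M_(2 * p, n)).
  rewrite -mulmxA mul_pid_mx !minnn.
  apply/matrixP=> i j; rewrite A0E !mul_diag_mx.
  rewrite (_ : pid_mx (2 * p) = diag_mx (\row_(j < n) (j < 2 * p)%N%:R)); last first.
    by apply/matrixP=> k1 k2; rewrite !mxE -val_eqE; case: eqP.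
  rewrite mul_mx_diag !mxE; case: ltnP => j2p; rewrite ?mulr1 // mulr0.
  have B0E : dmx n' p m a *m B0 + B0 *m dmx n' p m a = 0.
    by move: AB0; rewrite /Zn /= A0E.
  have := (anticomm_dmxP dim_eq _ ga).1 B0E i j.
  rewrite /tp_opp tp_diagE; case: ifP => ilt; last by rewrite mul0r.
  by move=> ->; rewrite ?mulr0 //; lia.
apply: contrapT => /eqP; rewrite -unitfE -unitmxE => /mxrank_unit.
suff : (\rank (P *m (g *m A0 *m invmx g *m (g *m B0 *m invmx g)) *m Q) <= 2 * p)%N by lia.
have -> : P *m (g *m A0 *m invmx g *m (g *m B0 *m invmx g)) *m Q =
    P *m g *m (A0 *m B0) *m invmx g *m Q by rewrite !mulmxA mulmxKV.
rewrite AB; set J := pid_mx _; set J' := pid_mx _.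
rewrite (_ : _ *m Q = (P *m g *m (A0 *m B0) *m J) *m (J' *m invmx g *m Q)).
  exact: mulmx_max_rank.
by rewrite !mulmxA.
Qed.

(** Ones between partners and the distinct diagonal entries 1, ..., r on the null block: with a_k =
    k + 1, all three rank bounds are attained at once. *)
Definition sep_B : 'M[K]_n := \matrix_(i, j)
  if tp_opp p m i j then (if i == j then (i - (2 * p + m)).+1%:R else (i < 2 * p)%N%:R) else 0.
Definition sep_point : mxpair K n := (dmx n' p m (fun k => k.+1%:R), sep_B).

Lemma Zcirc_sep : Zcirc K n p m r sep_point.
Proof.
split=> //; have ga := @good_params_succ K p m.
exists 1%:M, (dmx n' p m (fun k => k.+1%:R)), sep_B, (fun k => k.+1%:R).
split=> //; first exact: unitmx1.
- by apply/(anticomm_dmxP dim_eq) => // i j /negPf nij; rewrite mxE nij.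
- by rewrite !mul1mx invmx1 !mulmx1.
Qed.

Lemma sep_hankel1 : \det (hankel m (fun s => tr_odd1 s sep_point)) != 0.
Proof.
apply: (@det_hankel_sum m (fun k => (p + k).+1%:R) (fun k => (p + k).+1%:R ^+ 2)).
- by move=> i _; rewrite pnatr_eq0.
- by move=> i j ij; rewrite -!natrX eqr_nat; apply/eqP; nia.
by move=> s; rewrite /tr_odd1 /= (tr_odd_A dim_eq erefl).
Qed.

Lemma sep_hankel2 : \det (hankel r (fun s => tr_odd2 s sep_point)) != 0.
Proof.
apply: (@det_hankel_sum r (fun k => k.+1%:R) (fun k => k.+1%:R ^+ 2)).
- by move=> i _; rewrite pnatr_eq0.
- by move=> i j ij; rewrite -!natrX eqr_nat; apply/eqP; nia.
move=> s; have AB0 : Zn K n sep_point.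
  by apply/(anticomm_dmxP dim_eq _ (@good_params_succ K p m)) => i j /negPf nij; rewrite mxE nij.
rewrite /tr_odd2 /= (tr_odd_B dim_eq s (@good_params_succ K p m) erefl AB0).
rewrite (_ : \matrix_(i, j) _ = diag_mx (\row_(i < r) i.+1%:R)).
  rewrite diag_mx_exp mxtrace_diag; apply: eq_bigr => k _.
  by rewrite !mxE exprS exprM.
apply/matrixP=> i j; rewrite !mxE /= -val_eqE /= eqn_add2l.
have -> : tp_opp p m (2 * p + m + i) (2 * p + m + j) by rewrite /tp_opp; lia.
rewrite addKn -val_eqE /=; case: eqP => //= _.
by rewrite (_ : (2 * p + m + i < 2 * p)%N = false) //; lia.
Qed.

Lemma sep_det12 : exists (P : 'M[K]_(2 * p, n)) Q,
  \det (P *m (sep_point.1 *m sep_point.2) *m Q) != 0.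
Proof.
pose d (k : nat) : K := tp_diag p m (fun k => k.+1%:R) k.
(* For i below 2p, row i of the product A B is [d i] at the partner of i, so [W] inverts it on the
   first 2p coordinates. *)
pose W : 'M[K]_n := \matrix_(j, l)
  if [&& j < 2 * p, l < 2 * p, j != l & j./2 == l./2]%N then (d l)^-1 else 0.
have WE : sep_point.1 *m sep_point.2 *m W = pid_mx (2 * p).
  apply/matrixP=> i l; rewrite mul_diag_mx !mxE.
  have [i2p|i2p] := ltnP i (2 * p); last first.
    rewrite big1 => [|j _]; first by rewrite andbF.
    rewrite !mxE /tp_opp; case: ifP; last by rewrite mulr0 mul0r.
    by move=> oij; rewrite [X in _ * X]ifF ?mulr0 //; lia.
  have jn : ((if odd i then i.-1 else i.+1) < n)%N by case: ifP; lia.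
  rewrite (bigD1 (Ordinal jn)) //= big1 ?addr0 => [|j]; last first.
    rewrite -val_eqE /= => ji; rewrite !mxE ifF ?mulr0 ?mul0r //.
    by move: ji; rewrite /tp_opp; case: ifP; lia.
  rewrite !mxE /= ifT; last by rewrite /tp_opp; case: ifP; lia.
  rewrite ifF; last by rewrite -val_eqE /=; case: ifP; lia.
  rewrite i2p mulr1; case: (eqVneq i l) => [<-|il].
    rewrite eqxx /= ifT; last by rewrite -val_eqE /=; case: ifP; lia.
    rewrite divff // /d tp_diagE ifT; last by lia.
    by rewrite mulf_eq0 signr_eq0 pnatr_eq0.
  rewrite -val_eqE /= in il; rewrite (negPf il) /= ifF ?mulr0 //.
  by rewrite -val_eqE /=; case: ifP; lia.
exists (pid_mx (2 * p)), (W *m pid_mx (2 * p)).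
rewrite -mulmxA [_ *m (W *m _)]mulmxA WE !mul_pid_mx.
rewrite (_ : minn _ _ = 2 * p)%N ?pid_mx_1 ?det1 ?oner_neq0 //; lia.
Qed.

End Separation.

Lemma Zpmr_sub_eq n' p m r p' m' r' :
  (2 * p + m + r = n'.+1)%N -> (2 * p' + m' + r' = n'.+1)%N ->
  psubset (Zpmr K n'.+1 p m r) (Zpmr K n'.+1 p' m' r') ->
  [/\ p = p', m = m' & r = r'].
Proof.
move=> e e' sub; have /zclosureP cl := sub _ (sub_zclosure (Zcirc_sep e)).
have mm : (m <= m')%N.
  rewrite leqNgt; apply/negP => lt; have := sep_hankel1 e.
  rewrite (cl _ (polyfun_hankel m (@polyfun_tr_odd1 n'))) ?eqxx // => y.
  exact: Zcirc_hankel1.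
have rr : (r <= r')%N.
  rewrite leqNgt; apply/negP => lt; have := sep_hankel2 e.
  rewrite (cl _ (polyfun_hankel r (@polyfun_tr_odd2 n'))) ?eqxx // => y.
  exact: Zcirc_hankel2.
have pp : (p <= p')%N.
  rewrite leqNgt; apply/negP => lt; have [P [Q]] := sep_det12 e.
  rewrite (cl (fun x => \det (P *m (x.1 *m x.2) *m Q))) ?eqxx // => [|y].
    have PA := polyfun_falg K n'.+1.
    apply: falg_det => //; apply: mxfalgM => //; last exact: mxfalgC.
    apply: mxfalgM => //; first exact: mxfalgC.
    by apply: mxfalgM => //; [apply: polyfun_mx1 | apply: polyfun_mx2].
  by apply: Zcirc_det12 => //; lia.
by split; lia.
Qed.

End Hankel.

(** * Pairs with simple nonzero eigenvalues *)

Section SimpleDiag.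
Variable K : numClosedFieldType.

Lemma conj_anticomm n (g A B : 'M[K]_n) : g \in unitmx ->
  (g *m A *m invmx g) *m (g *m B *m invmx g) + (g *m B *m invmx g) *m (g *m A *m invmx g)
  = g *m (A *m B + B *m A) *m invmx g.
Proof. by move=> ug; rewrite !mulmxA !(mulmxKV ug) -mulmxDl -!mulmxA -mulmxDr mulmxA. Qed.

(** The eigenvalue 0 may be repeated; the others are simple. *)
Definition simple_diag n : pset K n := fun x =>
  Zn K n x /\ exists (g : 'M[K]_n) (d : 'rV[K]_n),
    [/\ g \in unitmx, forall i j, d 0 i != 0 -> d 0 i = d 0 j -> i = j &
        x.1 = g *m diag_mx d *m invmx g].

(** ps keeps one member of each pair x, - x present in s, and ms the elements whose opposite is
    absent. *)
Lemma pm_pairing (s : seq K) : uniq s -> 0 \notin s ->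
  exists ps ms, [/\ perm_eq s (flatten [seq [:: x; - x] | x <- ps] ++ ms),
    uniq (ps ++ ms) & {in ps ++ ms &, forall x y, x != - y}].
Proof.
move: {2}(size s).+1 (ltnSn (size s)) => k; elim: k s => // k IHk [|x s] /=.
  by exists [::], [::].
rewrite ltnS inE negb_or => sk /andP[xs us] /andP[x0 s0].
have xNx : x != - x.
  by rewrite -addr_eq0 -mulr2n mulrn_eq0 /= eq_sym x0.
have sub (t : seq K) ps ms : perm_eq t (flatten [seq [:: x; - x] | x <- ps] ++ ms) ->
    {subset ps ++ ms <= t}.
  move=> pt y; rewrite (perm_mem pt) !mem_cat => /orP[yps|->]; last by rewrite orbT.
  by apply/orP; left; apply/flatten_mapP; exists y => //; rewrite mem_head.
have ext ps ms (t : seq K) : {subset ps ++ ms <= t} -> x \notin t -> - x \notin t ->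
    {in ps ++ ms &, forall x y, x != - y} ->
    {in x :: ps ++ ms &, forall x y, x != - y}.
  move=> st xt nxt good y z; rewrite !inE.
  case: (eqVneq y x) => [->|_] /=; case: (eqVneq z x) => [->|_] //= yt zt.
  - by rewrite eq_sym eqr_oppLR; apply: contraNneq nxt => <-; apply: st.
  - by apply: contraNneq nxt => <-; apply: st.
  - exact: good.
case: (boolP (- x \in s)) => nxs.
  have [|||ps [ms [pe upm good]]] := IHk (rem (- x) s).
  - by rewrite size_rem //; case: (s) sk nxs => //= ? ? ? _; lia.
  - exact: rem_uniq.
  - by apply: contra s0; apply: mem_rem.
  have st := sub _ _ _ pe; have nxr : - x \notin rem (- x) s by rewrite mem_rem_uniq // !inE eqxx.
  have xr : x \notin rem (- x) s by apply: contra xs; apply: mem_rem.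
  exists (x :: ps), ms; split; last exact: ext st xr nxr good.
    by rewrite /= perm_cons; apply: perm_trans (perm_to_rem nxs) _; rewrite perm_cons.
  by rewrite /= upm andbT; apply: contra xr; apply: st.
have [//|//|//|ps [ms [pe upm good]]] := IHk s.
have st := sub _ _ _ pe; exists ps, (x :: ms); split.
- by rewrite perm_sym perm_catC /= perm_cons perm_catC perm_sym.
- rewrite uniq_catC /= uniq_catC upm andbT mem_cat orbC -mem_cat.
  by apply: contra xs; apply: st.
move=> y z; have E w : (w \in ps ++ x :: ms) = (w \in x :: ps ++ ms).
  by rewrite !(mem_cat, inE) orbCA.
by rewrite !E; apply: ext st xs nxs good y z.
Qed.

Lemma nth_pm_pairs (ps : seq K) i : (i < 2 * size ps)%N ->
  nth 0 (flatten [seq [:: x; - x] | x <- ps]) i =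
  if odd i then - nth 0 ps i./2 else nth 0 ps i./2.
Proof.
elim: ps i => [|x ps IHps] i /=; first by rewrite muln0.
by case: i => [|[|i]] //= ik; rewrite negbK IHps //; lia.
Qed.

Lemma size_pm_pairs (ps : seq K) :
  size (flatten [seq [:: x; - x] | x <- ps]) = (2 * size ps)%N.
Proof. by elim: ps => //= x ps ->; lia. Qed.

Lemma tp_diag_perm n (d : 'rV[K]_n) : (forall i j, d 0 i != 0 -> d 0 i = d 0 j -> i = j) ->
  exists p m r a (s : 'S_n), [/\ (2 * p + m + r)%N = n, good_params p m a &
    forall i, d 0 i = tp_diag p m a (s i)].
Proof.
move=> simp; pose l := [seq d 0 i | i <- enum 'I_n].
pose nz := [pred x : K | x != 0].
have unz : uniq (filter nz l).
  rewrite filter_map map_inj_in_uniq.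
    exact/filter_uniq/enum_uniq.
  move=> i j.
  by rewrite !mem_filter => /andP[di _] _; apply: simp.
have [|ps [ms [pe upm good]]] := pm_pairing unz; first by rewrite mem_filter /= eqxx.
pose p := size ps; pose m := size ms; pose r := count (predC nz) l.
pose a := nth 0 (ps ++ ms).
have szl : (2 * p + m + r)%N = n.
  rewrite -[RHS](size_enum_ord n) -(size_map (d 0)) -/l -(count_predC nz l).
  by rewrite -size_filter (perm_size pe) size_cat size_pm_pairs.
have ga : good_params p m a.
  have memn i : (i < p + m)%N -> a i \in ps ++ ms.
    by move=> ipm; apply: mem_nth; rewrite size_cat.
  split=> [i ipm|i j ipm jpm ij].
    by apply: contraTneq (good _ _ (memn i ipm) (memn i ipm)) => ->; rewrite oppr0 eqxx.
  by rewrite good ?memn // nth_uniq ?size_cat.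
have pl : perm_eq l (mkseq (tp_diag p m a) n).
  have -> : mkseq (tp_diag p m a) n =
      flatten [seq [:: x; - x] | x <- ps] ++ ms ++ nseq r 0.
    apply: (@eq_from_nth _ 0).
      by rewrite size_mkseq !size_cat size_pm_pairs size_nseq -szl addnA.
    move=> i; rewrite size_mkseq => il; rewrite nth_mkseq // !nth_cat size_pm_pairs.
    rewrite /tp_diag -/p -/m; case: ltnP => i1.
      by rewrite nth_pm_pairs // /a nth_cat (_ : (i./2 < size ps)%N) //; lia.
    case: ltnP => i2.
      rewrite /a nth_cat (_ : (i - p < size ps)%N = false) ?ifT; [|lia..].
      by rewrite /=; congr (nth _ _ _); rewrite /p -subnDA addnn mul2n.
    by rewrite ifF ?nth_nseq ?if_same //; lia.
  have E0 : filter (predC nz) l = nseq r 0.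
    rewrite /r -size_filter; apply/all_pred1P/allP => x.
    by rewrite mem_filter /= negbK => /andP[].
  apply: perm_trans (_ : perm_eq (filter nz l ++ filter (predC nz) l) _).
    by rewrite perm_sym (perm_filterC nz l).
  by rewrite E0 catA perm_cat2r.
have tE : mkseq (tp_diag p m a) n = [tuple tp_diag p m a i | i < n].
  by rewrite /mkseq -val_enum_ord -map_comp /= /map_tuple /=; congr map; rewrite val_ord_tuple.
move: pl; rewrite tE => /tuple_permP[s ls]; exists p, m, r, a, s; split=> // i.
have := congr1 (fun u => nth 0 u i) ls.
rewrite /l (nth_map i) ?size_enum_ord // nth_ord_enum => ->.
by rewrite -tnth_nth !tnth_mktuple.
Qed.

Lemma simple_diag_Zcirc n x : @simple_diag n x -> exists p m r, Zcirc K n p m r x.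
Proof.
case: x => A B [AB [g [d [ug simp /= AE]]]].
have [p [m [r [a [s [e ga ds]]]]]] := tp_diag_perm simp; exists p, m, r; split=> //.
have us : perm_mx s \in unitmx := unitmx_perm K s.
have [g' g'E] : exists g', g' = g *m perm_mx s by exists (g *m perm_mx s).
have ug' : g' \in unitmx by rewrite g'E unitmx_mul ug.
have g'V : invmx g' = invmx (perm_mx s) *m invmx g.
  by apply: (can_inj (mulKmx ug')); rewrite mulmxV // g'E mulmxA mulmxK // mulmxV.
pose D := diag_mx (\row_(i < n) tp_diag p m a i).
have dE : diag_mx d = perm_mx s *m D *m invmx (perm_mx s).
  have -> : invmx (perm_mx s) = perm_mx s^-1 :> 'M[K]_n.
    by apply: (can_inj (mulKmx us)); rewrite mulmxV // -perm_mxM mulgV perm_mx1.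
  apply/matrixP=> i j; rewrite -mulmxA -col_permE -row_permE !mxE ds.
  by rewrite (inj_eq perm_inj).
have AE' : A = g' *m D *m invmx g' by rewrite AE dE g'V g'E !mulmxA.
exists g', D, (invmx g' *m B *m g'), a; split=> //.
  have -> : D = invmx g' *m A *m g'. by rewrite AE' !mulmxA mulVmx // mul1mx mulmxKV.
  have := congr1 (fun M => invmx g' *m M *m g') AB; rewrite /Zn /= mulmx0 mul0mx => <-.
  by rewrite mulmxDr mulmxDl !mulmxA !mulmxK.
congr (_, _); rewrite // !mulmxA mulmxV // mul1mx -mulmxA mulmxV // mulmx1 //.
Qed.

Definition dsum n1 n2 (x : mxpair K n1) (y : mxpair K n2) : mxpair K (n1 + n2) :=
  (block_mx x.1 0 0 y.1, block_mx x.2 0 0 y.2).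

Lemma Zn_dsum n1 n2 (x : mxpair K n1) (y : mxpair K n2) :
  Zn K _ (dsum x y) <-> Zn K _ x /\ Zn K _ y.
Proof.
rewrite /Zn /dsum /= !mulmx_block !(mulmx0, mul0mx, addr0, add0r) add_block_mx !addr0.
split=> [/eqP|[-> ->]]; last exact: block_mx_const.
by rewrite block_mx_eq0 => /and4P[/eqP-> _ _ /eqP->].
Qed.

(* Scaling the second summand makes the nonzero eigenvalues distinct again. *)
Lemma simple_diag_dsum n1 n2 (x : mxpair K n1) (y : mxpair K n2) :
  simple_diag x -> simple_diag y -> zclosure (@simple_diag _) (dsum x y).
Proof.
case: x => A1 B1 [AB1 [g1 [d1 [ug1 s1 /= A1E]]]].
case: y => A2 B2 [AB2 [g2 [d2 [ug2 s2 /= A2E]]]].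
(* Its roots are the bad scalings t: zero, and those where a nonzero eigenvalue of the first summand
   equals t times one of the second. *)
pose w : {poly K} := 'X * \prod_i \prod_(j | d1 0 i != 0) ((d1 0 i)%:P - d2 0 j *: 'X).
have w0 : w != 0.
  rewrite mulf_neq0 ?polyX_eq0 //; apply/prodf_neq0 => i _; apply/prodf_neq0 => j di.
  apply: contraNneq di => /(congr1 (horner^~ 0)).
  by rewrite /= !hornerE ?mulr0 ?subr0 => ->.
have [t0 wt0] := poly_neq0_root w0.
have UA := upoly_falg K.
have -> : dsum (A1, B1) (A2, B2) = dsum (A1, B1) (1 *: A2, B2) by rewrite scale1r.
apply: (@zclosure_curve K _ _ (fun t => dsum (A1, B1) (t *: A2, B2)) (horner w) 1 t0) => //.
- apply: mxfalg_block => //; try exact: mxfalgC.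
  by apply: mxfalgZ => //; [apply: upoly_id | apply: mxfalgC].
- exact: (mxfalgC UA (block_mx B1 0 0 B2)).
- by exists w.
move=> t wt; split.
  apply/Zn_dsum; split=> //; rewrite /Zn /= -scalemxAl -scalemxAr -scalerDr.
  by rewrite (_ : _ + _ = 0) ?scaler0.
have [t_neq0 dd] : t != 0 /\ forall i j, d1 0 i != 0 -> d1 0 i != t * d2 0 j.
  move: wt; rewrite hornerM hornerX mulf_eq0 negb_or horner_prod => /andP[-> /prodf_neq0 H].
  split=> // i j di; have := H i isT; rewrite horner_prod => /prodf_neq0/(_ j di).
  by rewrite !hornerE subr_eq0 mulrC.
have ug : block_mx g1 0 0 g2 *m block_mx (invmx g1) 0 0 (invmx g2) = 1%:M.
  by rewrite mulmx_block !(mulmx0, mul0mx, addr0, add0r) !mulmxV // -scalar_mx_block.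
have [u _] := mulmx1_unit ug.
exists (block_mx g1 0 0 g2), (row_mx d1 (t *: d2)); split=> //.
  move=> i j; case: (split_ordP i) => k ->; case: (split_ordP j) => l ->;
    rewrite ?row_mxEl ?row_mxEr ?[(t *: d2) _ _]mxE.
  - by move=> dk dkl; congr lshift; apply: s1.
  - by move=> dk /eqP; rewrite (negPf (dd _ _ dk)).
  - by move=> + e; rewrite e => H; have := dd _ k H; rewrite -e eqxx.
  - rewrite mulf_eq0 negb_or => /andP[_ dk] /(mulfI t_neq0) dkl; congr rshift.
    exact: s2.
have -> : invmx (block_mx g1 0 0 g2) = block_mx (invmx g1) 0 0 (invmx g2).
  by apply: (can_inj (mulKmx u)); rewrite mulmxV // ug.
rewrite diag_mx_row !mulmx_block !(mulmx0, mul0mx, addr0, add0r) /= A1E A2E.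
congr block_mx; by rewrite linearZ /= -scalemxAr -scalemxAl.
Qed.

Lemma zclosure_dsum n1 n2 (x : mxpair K n1) (y : mxpair K n2) :
  zclosure (@simple_diag _) x -> zclosure (@simple_diag _) y ->
  zclosure (@simple_diag _) (dsum x y).
Proof.
have P1 := polyfun_falg K n1; have P2 := polyfun_falg K n2.
move=> cx cy; move: x cx; apply: zclosure_preim => [||x sx].
- by apply: mxfalg_block => //; try exact: mxfalgC; apply: polyfun_mx1.
- by apply: mxfalg_block => //; try exact: mxfalgC; apply: polyfun_mx2.
move: y cy; apply: zclosure_preim => [||y sy].
- by apply: mxfalg_block => //; try exact: mxfalgC; apply: polyfun_mx1.
- by apply: mxfalg_block => //; try exact: mxfalgC; apply: polyfun_mx2.
exact: simple_diag_dsum.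
Qed.

Lemma zclosure_conj n (P P' : 'M[K]_n) x : P' *m P = 1%:M ->
  zclosure (@simple_diag n) x -> zclosure (@simple_diag n) (P' *m x.1 *m P, P' *m x.2 *m P).
Proof.
move=> PP; have [uP' uP] := mulmx1_unit PP.
have PE : P = invmx P' by apply: (can_inj (mulKmx uP')); rewrite PP mulmxV.
move: x; apply: zclosure_preim => [||x [Zx [g [d [ug simp xE]]]]].
- have PA := polyfun_falg K n; apply: mxfalgM => //; last exact: mxfalgC.
  by apply: mxfalgM => //; [exact: mxfalgC | exact: polyfun_mx1].
- have PA := polyfun_falg K n; apply: mxfalgM => //; last exact: mxfalgC.
  by apply: mxfalgM => //; [exact: mxfalgC | exact: polyfun_mx2].
apply: sub_zclosure; split.
  by rewrite /Zn PE /= conj_anticomm // Zx mulmx0 mul0mx.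
have ug' : P' *m g \in unitmx by rewrite unitmx_mul uP' ug.
exists (P' *m g), d; split=> //.
have -> : invmx (P' *m g) = invmx g *m P.
  by apply: (can_inj (mulKmx ug')); rewrite mulmxV // mulmxA mulmxK // PP.
by rewrite xE !mulmxA.
Qed.

(** M has a single eigenvalue, which must be its normalized trace; in this form the condition is
    polynomial in M. *)
Definition unispectral n (M : 'M[K]_n.+1) := (M - (\tr M / n.+1%:R)%:M) ^+ n.+1 = 0.

Lemma char_poly_scalar n (b : K) : char_poly (b%:M : 'M_n) = ('X - b%:P) ^+ n.
Proof.
rewrite /char_poly (_ : char_poly_mx _ = ('X - b%:P)%:M) ?det_scalar //.
by apply/matrixP=> i j; rewrite !mxE mulrnBl; case: eqP; rewrite ?mulr1n ?mulr0n ?subrr ?subr0.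
Qed.

Lemma unispectralP n (M : 'M[K]_n.+1) b : char_poly M = ('X - b%:P) ^+ n.+1 -> unispectral M.
Proof.
move=> cM; have trE : \tr M = b *+ n.+1.
  rewrite -mxtrace_scalar; apply: oppr_inj.
  by rewrite -!char_poly_trace // char_poly_scalar cM.
rewrite /unispectral trE -[b *+ _]mulr_natr mulfK ?pnatr_eq0 //.
have := Cayley_Hamilton M.
by rewrite cM rmorphXn rmorphB /= horner_mx_X horner_mx_C.
Qed.

(** Write the characteristic polynomial of M as (X - b)^k q with q(b) nonzero; q is not constant as
    M has another eigenvalue. The kernels of the two factors at M are complementary and stable under
    A and B. *)
Lemma split_commuting n (A B M : 'M[K]_n.+1) : comm_mx M A -> comm_mx M B ->
  ~ unispectral M ->
  exists n1 n2 (P : 'M[K]_(n1 + n2, n.+1)) P' x1 x2,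
    [/\ (0 < n1)%N, (0 < n2)%N, P *m P' = 1%:M, P' *m P = 1%:M &
        A = P' *m (dsum x1 x2).1 *m P /\ B = P' *m (dsum x1 x2).2 *m P].
Proof.
move=> MA MB nuni; pose c := char_poly M.
have [b cb] : exists b, root c b.
  by apply/closed_rootP; rewrite size_char_poly.
have c0 : c != 0 by rewrite -size_poly_eq0 size_char_poly.
have [k [q nqb cE]] := multiplicity_XsubC c b; rewrite c0 /= in nqb.
have k0 : (0 < k)%N.
  by rewrite lt0n; apply: contraNneq nqb => k0; move: cb; rewrite cE k0 expr0 mulr1.
have cop : coprimep (('X - b%:P) ^+ k) q.
  by apply: coprimep_expl; rewrite coprimep_sym coprimep_XsubC.
pose W1 := kermxpoly M (('X - b%:P) ^+ k); pose W2 := kermxpoly M q.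
have W12 : (W1 + W2 :=: 1%:M)%MS.
  apply: eqmx_trans (kermxpoly_min (g := M) (p := c) (mxminpoly_dvd_char M)).
  by apply: eqmx_sym; rewrite cE mulrC; apply: kermxpolyM.
have dW : (W1 :&: W2 = 0)%MS by apply: mxdirect_kermxpoly.
have ker0 (p : {poly K}) a : root p a -> root c a -> kermxpoly M p != 0.
  move=> pa; rewrite -eigenvalue_root_char => /eigenvalueP[v vM v0].
  apply: contraNneq v0 => K0; rewrite -submx0 -K0; apply/sub_kermxP.
  have : forall s : {poly K}, v *m horner_mx M s = s.[a] *: v.
    elim/poly_ind => [|s e IHs]; first by rewrite rmorph0 mulmx0 horner0 scale0r.
    rewrite rmorphD rmorphM /= horner_mx_X horner_mx_C mulmxDr -mulmxE mulmxA IHs.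
    by rewrite -scalemxAl vM scalerA mul_mx_scalar -scalerDl !hornerE.
  by move->; move/rootP: pa => ->; rewrite scale0r.
have W1n : (0 < \rank W1)%N.
  rewrite lt0n mxrank_eq0; apply: (ker0 _ b) => //.
  by rewrite rootE horner_exp !hornerE subrr expr0n (gtn_eqF k0).
have q1 : size q != 1.
  apply/negP => /size_poly1P[e e0 qE]; apply: nuni.
  have mc : lead_coef c = 1 by apply/monicP/char_poly_monic.
  have e1 : e = 1.
    by move: mc; rewrite cE qE lead_coefM lead_coefC (monicP (monic_exp _ (monicXsubC b))) mulr1.
  have := size_char_poly M; rewrite -/c cE qE e1 mul1r size_exp_XsubC => -[kn].
  by apply: (@unispectralP _ _ b); rewrite -/c cE qE e1 mul1r kn.
have W2n : (0 < \rank W2)%N.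
  have [a qa] := closed_rootP _ q1.
  rewrite lt0n mxrank_eq0; apply: (ker0 _ a) => //.
  by rewrite cE rootM qa.
pose P := col_mx (row_base W1) (row_base W2).
have PE : (P :=: 1%:M)%MS.
  apply: eqmx_trans W12; apply: eqmx_trans (eqmx_sym (addsmxE _ _)) _.
  by apply: adds_eqmx; apply: eq_row_base.
have r12 : (\rank W1 + \rank W2)%N = n.+1.
  by rewrite -mxrank_disjoint_sum // W12 mxrank1.
have fP : row_free P by rewrite /row_free PE mxrank1 r12.
have fuP : row_full P by rewrite /row_full PE mxrank1.
(* P is invertible, but its number of rows is [n.+1] only up to a proved equality, hence
   [pinvmx]. *)
exists (\rank W1), (\rank W2), P, (pinvmx P).
have stab N (W : 'M_n.+1) p : comm_mx M N -> W = kermxpoly M p ->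
    exists N1, row_base W *m N = N1 *m row_base W.
  move=> MN ->; apply/submxP.
  have st : (kermxpoly M p *m N <= kermxpoly M p)%MS := comm_mx_stable_kermxpoly p MN.
  by rewrite eq_row_base (eqmxMr N (eq_row_base _)).
have [A1 A1E] := stab A W1 _ MA erefl; have [A2 A2E] := stab A W2 _ MA erefl.
have [B1 B1E] := stab B W1 _ MB erefl; have [B2 B2E] := stab B W2 _ MB erefl.
exists (A1, B1), (A2, B2); split=> //; [exact: mulmxVp | exact: mulVpmx | ].
have PV : pinvmx P *m P = 1%:M by apply: mulVpmx.
split=> /=.
  rewrite -mulmxA mul_block_col !mul0mx addr0 add0r -A1E -A2E -mul_col_mx.
  by rewrite mulmxA PV mul1mx.
rewrite -mulmxA mul_block_col !mul0mx addr0 add0r -B1E -B2E -mul_col_mx.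
by rewrite mulmxA PV mul1mx.
Qed.

Lemma zclosure_dsum_conj n n1 n2 (x : mxpair K n) x1 x2
    (P : 'M_(n1 + n2, n)) (P' : 'M_(n, n1 + n2)) :
  (forall k (y : mxpair K k), (k < n)%N -> Zn K k y -> zclosure (@simple_diag k) y) ->
  Zn K _ x -> (0 < n1)%N -> (0 < n2)%N -> P *m P' = 1%:M -> P' *m P = 1%:M ->
  x.1 = P' *m (dsum x1 x2).1 *m P -> x.2 = P' *m (dsum x1 x2).2 *m P ->
  zclosure (@simple_diag _) x.
Proof.
move=> IHn Zx n1_gt0 n2_gt0 PP' P'P E1 E2.
have nE : n = (n1 + n2)%N.
  apply/eqP; rewrite eqn_leq -{1}(mxrank1 K n) -{1}P'P mulmx_max_rank.
  by rewrite -(mxrank1 K (n1 + n2)) -PP' mulmx_max_rank.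
subst n; have -> : x = (P' *m (dsum x1 x2).1 *m P, P' *m (dsum x1 x2).2 *m P).
  by rewrite -E1 -E2 -surjective_pairing.
have [uP' _] := mulmx1_unit P'P.
have /Zn_dsum[Z1 Z2] : Zn K _ (dsum x1 x2).
  have PE : P = invmx P' by apply: (can_inj (mulKmx uP')); rewrite P'P mulmxV.
  have := Zx; rewrite /Zn E1 E2 PE conj_anticomm // => H.
  apply: (can_inj (mulKmx uP')); apply: (can_inj (mulmxKV uP')).
  by rewrite /= H mulmx0 mul0mx.
apply: zclosure_conj => //; apply: zclosure_dsum; apply: IHn => //; lia.
Qed.

Lemma zclosure_split n (x : mxpair K n.+1) (M : 'M_n.+1) :
  (forall k (y : mxpair K k), (k < n.+1)%N -> Zn K k y -> zclosure (@simple_diag k) y) ->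
  Zn K _ x -> comm_mx M x.1 -> comm_mx M x.2 -> ~ unispectral M ->
  zclosure (@simple_diag _) x.
Proof.
move=> IHn Zx M1 M2 nuni.
have [n1 [n2 [P [P' [x1 [x2 [n1_gt0 n2_gt0 PP' P'P [E1 E2]]]]]]]] :=
  split_commuting M1 M2 nuni.
exact: zclosure_dsum_conj IHn Zx n1_gt0 n2_gt0 PP' P'P E1 E2.
Qed.

End SimpleDiag.

(** * Krylov bases and anticommuting matrices *)

Section Krylov.
Variables (K : numClosedFieldType) (n' : nat).
Local Notation n := n'.+1.
Implicit Types (A B M : 'M[K]_n) (v : 'rV[K]_n).

Lemma exists_row_neq0 M1 M2 : M1 != 0 -> M2 != 0 ->
  exists v, v *m M1 != 0 /\ v *m M2 != 0.
Proof.
have ex M : M != 0 -> exists v, v *m M != 0.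
  move=> M0; apply: contrapT => nex; case/eqP: M0; apply/row_matrixP=> i.
  by rewrite row0 rowE; apply: contrapT => /eqP vM; apply: nex; exists (delta_mx 0 i).
move=> /ex[v1 v1M] /ex[v2 v2M]; have [z12|] := eqVneq (v1 *m M2) 0; last by exists v1.
have [z21|] := eqVneq (v2 *m M1) 0; last by exists v2.
by exists (v1 + v2); rewrite !mulmxDl z12 z21 addr0 add0r.
Qed.

Lemma minpoly_proper_neq0 B (q : {poly K}) : q != 0 -> (size q < size (mxminpoly B))%N ->
  horner_mx B q != 0.
Proof.
by move=> q0 sq; apply/eqP => /mxminpoly_min/(dvdp_leq q0); rewrite leqNgt sq.
Qed.

(** With P the minimal polynomial, v avoids the kernels of P / (X - mu) and P / (X + mu) at B. If a
    nonzero q of smaller degree killed v, so would gcd(q, P) by Bezout, hence also P / (X - rho) for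
    some root rho of P. *)
Lemma krylov_free B mu : (B ^+ 2 - (mu ^+ 2)%:M) ^+ n = 0 ->
  exists v, forall q : {poly K}, (size q < size (mxminpoly B))%N ->
    v *m horner_mx B q = 0 -> q = 0.
Proof.
move=> Bmu; set P := mxminpoly B.
have P0 : P != 0 by apply/monic_neq0/mxminpoly_monic.
have sP : (1 < size P)%N by rewrite size_mxminpoly ltnS mxminpoly_nonconstant.
have rootP_ rho : root P rho -> rho = mu \/ rho = - mu.
  have /mxminpoly_min/dvdpP[u uE] : horner_mx B (('X^2 - (mu ^+ 2)%:P) ^+ n) = 0.
    by rewrite rmorphXn rmorphB rmorphXn /= horner_mx_X horner_mx_C.
  move/rootP => Pr; have /eqP := congr1 (horner^~ rho) uE.
  rewrite /= hornerM -/P Pr mulr0 horner_exp expf_eq0 /= !hornerE subr_eq0.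
  by rewrite eqf_sqr => /orP[/eqP|/eqP]; [left | right].
pose cof rho := P %/ ('X - rho%:P).
have cofN0 rho : horner_mx B (cof rho) != 0.
  have sc : size (cof rho) = (size P).-1.
    by rewrite size_divp ?polyXsubC_eq0 // size_XsubC subn1.
  by apply: minpoly_proper_neq0; rewrite -?size_poly_eq0 -/P sc; lia.
have [v [v1 v2]] := exists_row_neq0 (cofN0 mu) (cofN0 (- mu)).
exists v => q sq vq; apply/eqP; apply: contraT => q0.
pose g := gcdp q P.
have vg : v *m horner_mx B g = 0.
  have [[u1 u2] /= /eqpP[[c1 c2] /= /andP[c10 c20] uE]] := Bezoutp q P.
  apply: (can_inj (scalerK c20)); rewrite scaler0 scalemxAr -linearZ /= -uE.
  rewrite linearZ /= -scalemxAr rmorphD !rmorphM /= mx_root_minpoly mulr0 addr0.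
  by rewrite comm_horner_mx2 -mulmxE mulmxA vq mul0mx scaler0.
have gP : g %| P by apply: dvdp_gcdr.
have g0 : g != 0 by rewrite gcdp_eq0 negb_and q0.
have PE := divpK gP; set h := P %/ g in PE.
have sg : (size g <= size q)%N by apply: dvdp_leq => //; apply: dvdp_gcdl.
have [|rho hr] := closed_rootP h _.
  have gs : (0 < size g)%N by rewrite size_poly_gt0.
  rewrite size_divp //; move: gs (leq_ltn_trans sg sq).
  by move: (size g) (size P) => a b; lia.
have [h' hE] := factor_theorem _ _ hr.
have cofE : cof rho = h' * g.
  by rewrite /cof -PE hE mulrAC mulpK // polyXsubC_eq0.
have v0 : v *m horner_mx B (cof rho) = 0.
  by rewrite cofE mulrC rmorphM /= -mulmxE mulmxA vg mul0mx.
have [E|E] : rho = mu \/ rho = - mu by apply: rootP_; rewrite -PE rootM hr.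
  by rewrite -E v0 eqxx in v1.
by rewrite -E v0 eqxx in v2.
Qed.

Definition alt_sign d : 'M[K]_d := diag_mx (\row_(i < d) (-1) ^+ i).

(* R is the Horner scheme of the minimal polynomial at - B applied to a column dual to the
   Krylov rows Q, so that R *m Q anticommutes with B as soon as - B is a root. *)
Lemma krylov_pair B mu : (B ^+ 2 - (mu ^+ 2)%:M) ^+ n = 0 ->
  horner_mx (- B) (mxminpoly B) = 0 ->
  exists d (Q : 'M[K]_(d, n)) (R : 'M_(n, d)) v,
    [/\ (0 < d <= n)%N, forall i, row i Q = v *m B ^+ i,
        Q *m R = alt_sign d & B *m (R *m Q) + (R *m Q) *m B = 0].
Proof.
move=> Bmu PN; have [v vfree] := krylov_free Bmu.
set P := mxminpoly B in vfree PN; set d := degree_mxminpoly B.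
have sP : size P = d.+1 by apply: size_mxminpoly.
have d0 : (0 < d)%N by apply: mxminpoly_nonconstant.
have Pd : P`_d = 1.
  by have /monicP := mxminpoly_monic B; rewrite lead_coefE -/P sP.
pose Q : 'M[K]_(d, n) := \matrix_i (v *m B ^+ i).
have rowQ i : row i Q = v *m B ^+ i by rewrite rowK.
have freeQ : row_free Q.
  rewrite -kermx_eq0; apply/eqP/row_matrixP => k; rewrite row0.
  set u := row k _; have uQ : u *m Q = 0 by apply/sub_kermxP; apply: row_sub.
  have : \poly_(i < d) (u 0 (insubd (Ordinal d0) i)) = 0.
    apply: vfree; first by rewrite sP ltnS; apply: size_poly.
    rewrite poly_def linear_sum /= mulmx_sumr -[RHS]uQ mulmx_sum_row.
    apply: eq_bigr => i _; rewrite rowQ linearZ rmorphXn /= horner_mx_X -scalemxAr.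
    by congr (u 0 _ *: _); apply: val_inj; rewrite val_insubd ltn_ord.
  move=> p0; apply/rowP=> i; have := congr1 (fun p : {poly K} => p`_i) p0.
  rewrite coef_poly ltn_ord coef0 => u0; rewrite [RHS]mxE -[RHS]u0.
  by congr (u 0 _); apply: val_inj; rewrite val_insubd ltn_ord.
(* Dual to the last Krylov row; the sign cancels that of the top power of - B in [F 1]. *)
pose xi : 'cV[K]_n := pinvmx Q *m \col_(i < d) ((-1) ^+ d.-1 * (i == d.-1 :> nat)%:R).
have vxi i : (i < d)%N -> (v *m B ^+ i *m xi) 0 0 = (-1) ^+ d.-1 * (i == d.-1)%:R.
  move=> id; have := rowQ (Ordinal id) => /= <-.
  by rewrite -row_mul mulmxA mulmxVp // mul1mx !mxE.
clearbody xi; pose F j := horner_mx (- B) (drop_poly j P).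
have FS j : F j = F j.+1 *m (- B) + (P`_j)%:M.
  rewrite /F; have -> : drop_poly j P = drop_poly j.+1 P * 'X + (P`_j)%:P.
    apply/polyP=> k; rewrite coefD coefMX coefC !coef_drop_poly.
    by case: k => [|k] /=; rewrite ?add0r ?addr0 // addSnnS.
  by rewrite rmorphD rmorphM /= horner_mx_X horner_mx_C.
have F0 : F 0 = 0 by rewrite /F drop_poly0l.
have Fd : F d = 1%:M.
  rewrite /F (_ : drop_poly d P = 1) ?rmorph1 //; apply/polyP=> k.
  rewrite coef_drop_poly coef1; case: k => [|k] /=; first by rewrite add0n.
  by rewrite nth_default // sP; lia.
pose R : 'M[K]_(n, d) := \matrix_(i, j) (F j.+1 *m xi) i 0.
have colR j : col j R = F j.+1 *m xi by apply/colP=> i; rewrite !mxE.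
have QRE (i j : 'I_d) : (Q *m R) i j = (v *m B ^+ i *m F j.+1 *m xi) 0 0.
  rewrite -mulmxA -colR -rowQ !mxE; apply: eq_bigr => k _; by rewrite !mxE.
have BF j : B *m F j.+1 = (P`_j)%:M - F j.
  have -> : B *m F j.+1 = F j.+1 *m B.
    by rewrite /F; apply: comm_mx_horner; rewrite /comm_mx mulmxN mulNmx.
  by rewrite (FS j) mulmxN opprD opprK addrC subrK.
have XN k : (- B) ^+ k = (-1) ^+ k *: B ^+ k by rewrite -scaleN1r exprZn.
(* By [BF], passing from i to i + 1 lowers the index of F and changes the sign; for i = 0 only the
   top power of - B in [F 1] meets [xi]. *)
have G i j : (i < d)%N -> (j < d)%N ->
    (v *m B ^+ i *m F j.+1 *m xi) 0 0 = (-1) ^+ i * (i == j)%:R.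
  elim: i j => [|i IHi] j id jd; last first.
    have -> : v *m B ^+ i.+1 *m F j.+1 *m xi =
        P`_j *: (v *m B ^+ i *m xi) - v *m B ^+ i *m F j *m xi.
      rewrite exprSr -mulmxE !mulmxA -(mulmxA _ B) BF mulmxBr mulmxBl.
      by rewrite mul_mx_scalar -scalemxAl.
    rewrite mxE [X in X + _]mxE [X in _ + X]mxE vxi; last exact: ltnW.
    rewrite (_ : (i == d.-1) = false); last by apply/eqP; lia.
    rewrite !mulr0 add0r; case: j jd => [|j] jd.
      by rewrite F0 mulmx0 mul0mx mxE oppr0 mulr0.
    by rewrite IHi ?eqSS; [rewrite exprS mulN1r mulNr | lia..].
  have dd : (d.-1 < d)%N by lia.
  rewrite expr0 mulmx1 mul1r /F horner_mx_coefs mulmx_sumr mulmx_suml summxE.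
  rewrite size_drop_poly sP (big_ord_widen d
    (fun k => (v *m ((drop_poly j.+1 P)`_k *: (- B) ^+ k) *m xi) 0 0)); last by lia.
  rewrite big_mkcond /= (bigD1 (Ordinal dd)) //= big1 ?addr0 => [|k].
    rewrite coef_drop_poly; case: ifP => jj; last first.
      by case: eqP jj => // <-; lia.
    rewrite -scalemxAr -scalemxAl mxE XN.
    rewrite -scalemxAr -scalemxAl mxE vxi // eqxx mulr1 -exprD addnn -mul2n exprM sqrrN.
    rewrite !expr1n mulr1; case: j jd jj => [|j] jd jj; last by lia.
    by rewrite addn1 prednK // Pd.
  rewrite -val_eqE /= => kd; case: ifP => // _.
  rewrite -scalemxAr -scalemxAl mxE XN -scalemxAr -scalemxAl mxE vxi //.
  by rewrite (negPf kd) !mulr0.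
exists d, Q, R, v; split=> //.
- by rewrite d0 /=; rewrite -(eqP freeQ); apply: rank_leq_col.
- apply/matrixP=> i j; rewrite QRE G // /alt_sign !mxE -val_eqE.
  by case: eqP; rewrite ?mulr1 ?mulr0 ?mulr1n ?mulr0n // => ->.
have RQ : R *m Q = \sum_(j < d) F j.+1 *m (xi *m v *m B ^+ j).
  apply/matrixP=> a b; rewrite mxE summxE; apply: eq_bigr => j _.
  rewrite -[xi *m v *m _]mulmxA (mulmxA (F _)) -rowQ -colR [RHS]mxE big_ord1 !mxE //.
rewrite RQ mulmx_sumr mulmx_suml -big_split /=.
(* By [BF] the anticommutator telescopes; with F_0 = 0 and F_d = 1 what remains is [xi *m v] times
   P(B), which is zero. *)
pose T j := F j *m (xi *m v *m B ^+ j).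
have -> : \sum_(j < d) (B *m (F j.+1 *m (xi *m v *m B ^+ j)) +
    F j.+1 *m (xi *m v *m B ^+ j) *m B) =
    \sum_(j < d) (P`_j *: (xi *m v *m B ^+ j)) + \sum_(j < d) (T j.+1 - T j).
  rewrite -big_split; apply: eq_bigr => j _ /=.
  rewrite mulmxA BF mulmxBl mul_scalar_mx /T exprSr -mulmxE !mulmxA.
  by rewrite -addrA; congr (_ + _); rewrite addrC.
rewrite -(big_mkord xpredT (fun j => T j.+1 - T j)) telescope_sumr // /T F0 mul0mx subr0.
rewrite Fd mul1mx -[X in _ + X]scale1r -Pd.
rewrite -(big_ord_recr d (fun j => P`_j *: (xi *m v *m B ^+ j))) /=.
under eq_bigr => j _ do rewrite scalemxAr.
by rewrite -mulmx_sumr -sP -horner_mx_coefs mx_root_minpoly mulmx0.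
Qed.

End Krylov.

(** * Perturbation to a square with two eigenvalues *)

Section Density.
Variable K : numClosedFieldType.

Definition nonunispectral n : pset K n.+1 := fun y =>
  Zn K n.+1 y /\ (~ unispectral (y.1 ^+ 2) \/ ~ unispectral (y.2 ^+ 2)).

Lemma unispectral_singular n (M : 'M[K]_n.+1) : unispectral M -> M \notin unitmx ->
  \tr M = 0.
Proof.
rewrite /unispectral => uM; rewrite unitmxE unitfE negbK => /det0P[w w0 wM].
set c := \tr M / _ in uM; suff /eqP : c = 0.
  by rewrite mulf_eq0 invr_eq0 pnatr_eq0 orbF => /eqP.
have wk k : w *m (M - c%:M) ^+ k = (- c) ^+ k *: w.
  elim: k => [|k IHk]; first by rewrite !expr0 mulmx1 scale1r.
  rewrite exprS -mulmxE mulmxA mulmxBr wM sub0r mul_mx_scalar -scaleNr -scalemxAl IHk.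
  by rewrite scalerA -exprS.
have /eqP := wk n.+1; rewrite uM mulmx0 eq_sym scaler_eq0 (negPf w0) orbF expf_eq0 oppr_eq0.
by move/andP=> [_ /eqP].
Qed.

Lemma unispectral_tr0 n (M : 'M[K]_n.+1) : unispectral M -> \tr M = 0 -> M ^+ n.+1 = 0.
Proof.
rewrite /unispectral => + trM; rewrite trM mul0r (_ : 0%:M = 0) ?subr0 //.
by apply/matrixP=> i j; rewrite !mxE mul0rn.
Qed.

Lemma unispectral_sqrt n (M : 'M[K]_n.+1) : unispectral M ->
  exists mu : K, (M - (mu ^+ 2)%:M) ^+ n.+1 = 0.
Proof. by move=> uM; exists (sqrtC (\tr M / n.+1%:R)); rewrite sqrtCK. Qed.

Lemma nonunispectral_curve n (G : K -> mxpair K n.+1) t0 t1 :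
  mxfalg (@upoly K) (fun t => (G t).1) -> mxfalg (@upoly K) (fun t => (G t).2) ->
  (forall t, Zn K _ (G t)) ->
  ~ unispectral ((G t1).1 ^+ 2) \/ ~ unispectral ((G t1).2 ^+ 2) ->
  zclosure (@nonunispectral n) (G t0).
Proof.
move=> U1 U2 ZG; have UA := upoly_falg K.
have wit (H : K -> 'M[K]_n.+1) : mxfalg (@upoly K) H -> ~ unispectral (H t1 ^+ 2) ->
    exists w, [/\ upoly w, w t1 != 0 & forall t, w t != 0 -> ~ unispectral (H t ^+ 2)].
  move=> UH /eqP/matrix0Pn[i [j wij]].
  exists (fun t => ((H t ^+ 2 - (\tr (H t ^+ 2) / n.+1%:R)%:M) ^+ n.+1) i j).
  split=> // [|t + u]; last by rewrite u mxE eqxx.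
  apply: mxfalgX => //; apply: mxfalgB => //; first exact: mxfalgX.
  under [fun t => _]funext => t do rewrite -scalemx1.
  apply: mxfalgZ => //; last exact: mxfalgC.
  by apply: falgM => //; [apply: falg_tr => //; apply: mxfalgX | apply: falgC].
case=> [/(wit _ U1)|/(wit _ U2)] [w [Uw wt1 wE]];
  apply: (zclosure_curve t0 U1 U2 Uw wt1) => t /wE nu; split=> //.
  by left.
by right.
Qed.

Lemma Zn_line n (A A1 B : 'M[K]_n) t : Zn K n (A, B) -> Zn K n (A1, B) ->
  Zn K n ((1 - t) *: A + t *: A1, B).
Proof.
rewrite /Zn /= => AB A1B.
rewrite mulmxDl mulmxDr -!scalemxAl -!scalemxAr addrACA -!scalerDr AB A1B.
by rewrite !scaler0 addr0.
Qed.

Lemma upoly_line n (A A1 : 'M[K]_n) : mxfalg (@upoly K) (fun t => (1 - t) *: A + t *: A1).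
Proof.
have UA := upoly_falg K; apply: mxfalgD => //; apply: mxfalgZ => //; try exact: mxfalgC.
  by apply: falgB => //; [apply: falgC | apply: upoly_id].
exact: upoly_id.
Qed.

Lemma nonunispectral_line n (A A1 B : 'M[K]_n.+1) : Zn K _ (A, B) -> Zn K _ (A1, B) ->
  ~ unispectral (A1 ^+ 2) -> zclosure (@nonunispectral n) (A, B).
Proof.
move=> AB A1B nu.
have -> : (A, B) = ((1 - 0) *: A + 0 *: A1, B) :> mxpair K n.+1.
  by rewrite subr0 scale1r scale0r addr0.
apply: (@nonunispectral_curve n (fun t => ((1 - t) *: A + t *: A1, B)) 0 1).
- exact: upoly_line.
- exact: (mxfalgC (upoly_falg K)).
- by move=> t; apply: Zn_line.
- by left; rewrite /= subrr scale0r add0r scale1r.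
Qed.

Lemma alt_sign_sqr d : alt_sign K d *m alt_sign K d = 1%:M.
Proof.
rewrite mulmx_diag; apply/matrixP=> i j; rewrite !mxE -exprD addnn -mul2n exprM sqrrN.
by rewrite !expr1n.
Qed.

(** S = R Q has rank at most d, so its square is singular; but Q S^2 = Q with Q nonzero, so S^2 is
    not nilpotent. *)
Lemma krylov_deficient n (d : nat) (Q : 'M[K]_(d, n.+1)) (R : 'M_(n.+1, d)) :
  (0 < d < n.+1)%N -> Q *m R = alt_sign K d -> ~ unispectral ((R *m Q) ^+ 2).
Proof.
move=> /andP[d0 dn] QR uS; set S := R *m Q in uS.
have QS2 : Q *m S ^+ 2 = Q.
  by rewrite expr2 -mulmxE /S !mulmxA QR -(mulmxA _ Q R) QR alt_sign_sqr mul1mx.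
have nS : S ^+ 2 \notin unitmx.
  apply/negP => /mxrank_unit rS.
  have : (\rank (S ^+ 2) <= d)%N.
    rewrite expr2 -mulmxE /S mulmxA; exact: mulmx_max_rank.
  by rewrite rS leqNgt dn.
have S0 := unispectral_tr0 uS (unispectral_singular uS nS).
have QSk k : Q *m (S ^+ 2) ^+ k = Q.
  by elim: k => [|k IHk]; rewrite ?expr0 ?mulmx1 // exprS -mulmxE mulmxA QS2 IHk.
have Q0 : Q = 0 by rewrite -(QSk n.+1) S0 mulmx0.
have := QR; rewrite Q0 mul0mx => /matrixP/(_ (Ordinal d0) (Ordinal d0))/eqP.
by rewrite !mxE eqxx expr0 eq_sym oner_eq0.
Qed.

(** S A commutes with B, and a matrix commuting with B is determined by its value on the cyclic
    vector v. *)
Lemma cyclic_anticomm n (A B S Q : 'M[K]_n.+1) v : (forall i, row i Q = v *m B ^+ i) ->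
  Q \in unitmx -> S *m S = 1%:M -> Zn K _ (A, B) -> Zn K _ (S, B) ->
  exists q, A = S *m horner_mx B q.
Proof.
move=> rowQ uQ SS AB SB; pose u := v *m (S *m A) *m invmx Q.
have CB : S *m A *m B = B *m (S *m A).
  move: AB SB; rewrite /Zn /= => /eqP; rewrite addr_eq0 => /eqP AB /eqP.
  rewrite addr_eq0 => /eqP SB.
  by rewrite -mulmxA AB mulmxN (mulmxA S B) SB mulNmx opprK mulmxA.
have CBk k : S *m A *m B ^+ k = B ^+ k *m (S *m A).
  elim: k => [|k IHk]; first by rewrite expr0 mulmx1 mul1mx.
  by rewrite exprSr -mulmxE mulmxA IHk -mulmxA CB mulmxA.
pose q := \poly_(i < n.+1) u 0 (inord i); exists q.
suff -> : horner_mx B q = S *m A by rewrite mulmxA SS mul1mx.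
have vq : v *m horner_mx B q = v *m (S *m A).
  rewrite -[RHS](mulmxKV uQ) -/u [u *m Q]mulmx_sum_row /q poly_def linear_sum /= mulmx_sumr.
  apply: eq_bigr => i _; rewrite rowQ linearZ rmorphXn /= horner_mx_X -scalemxAr.
  by rewrite inord_val.
apply: (can_inj (mulKmx uQ)); apply/row_matrixP=> i; rewrite !row_mul rowQ.
have -> : v *m B ^+ i *m horner_mx B q = v *m horner_mx B q *m B ^+ i.
  rewrite -!mulmxA; congr (_ *m _); apply: comm_mx_horner.
  by rewrite /comm_mx -[B ^+ i *m B]exprSr -[B *m B ^+ i]exprS.
by rewrite vq -(mulmxA v (S *m A)) CBk mulmxA.
Qed.

Lemma anticomm_horner n (S B : 'M[K]_n.+1) q : Zn K _ (S, B) -> Zn K _ (S *m horner_mx B q, B).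
Proof.
rewrite /Zn /= => /eqP; rewrite addr_eq0 => /eqP SB.
have -> : S *m horner_mx B q *m B = S *m B *m horner_mx B q.
  rewrite -!mulmxA; congr (_ *m _); apply/esym; exact: comm_mx_horner.
by rewrite SB mulNmx mulmxA addNr.
Qed.

Lemma anticomm_sqr_comm n (A B : 'M[K]_n.+1) : A *m B + B *m A = 0 -> comm_mx (A ^+ 2) B.
Proof.
move/eqP; rewrite addr_eq0 => /eqP AB; rewrite /comm_mx expr2 -mulmxE.
by rewrite -mulmxA AB mulmxN (mulmxA A B) AB mulNmx opprK mulmxA.
Qed.

Lemma krylov_cyclic n (Q R : 'M[K]_n.+1) : Q *m R = alt_sign K n.+1 ->
  Q \in unitmx /\ (R *m Q) *m (R *m Q) = 1%:M.
Proof.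
move=> QR; have QRD : Q *m (R *m alt_sign K n.+1) = 1%:M.
  by rewrite mulmxA QR alt_sign_sqr.
have [uQ _] := mulmx1_unit QRD; split=> //; apply: (can_inj (mulKmx uQ)).
by rewrite !mulmxA QR -(mulmxA _ Q R) QR alt_sign_sqr mul1mx mulmx1.
Qed.

(* In the cyclic case, adding t to one entry of the companion matrix of B changes the trace
   of its square but not its determinant, so some B_t has two eigenvalues up to sign. *)
Lemma cyclic_perturb n (B Q : 'M[K]_n.+3) v :
  (forall i, row i Q = v *m B ^+ i) -> Q \in unitmx ->
  exists t, ~ unispectral
    ((B + t *: (invmx Q *m delta_mx ord_max (inord n.+1) *m Q)) ^+ 2).
Proof.
move=> rowQ uQ; set i2 : 'I_n.+3 := inord n.+1; pose i3 : 'I_n.+3 := inord n.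
have i2E : i2 = n.+1 :> nat by rewrite /i2 inordK //; lia.
have i3E : i3 = n :> nat by rewrite /i3 inordK //; lia.
set E := _ *m Q; pose C := Q *m B *m invmx Q.
(* In the Krylov basis B is a companion matrix: right multiplication by [C] shifts a unit row. *)
have rowC (i j : 'I_n.+3) : j = i.+1 :> nat -> row i C = delta_mx 0 j.
  move=> ij; rewrite !row_mul rowQ -(mulmxA v) -[B ^+ i *m B]exprSr -ij -rowQ -row_mul mulmxV //.
  by rewrite row1.
have dC (i j k : 'I_n.+3) : k = j.+1 :> nat -> delta_mx i j *m C = delta_mx i k.
  move=> kj; rewrite -(mul_delta_mx (0 : 'I_1)) -mulmxA -rowE (rowC _ k) //.
  by rewrite mul_delta_mx.
have BE : B = invmx Q *m C *m Q by rewrite !mulmxA mulVmx // mul1mx mulmxKV.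
clearbody C.
have trE (X : 'M_n.+3) : \tr (invmx Q *m X *m Q) = \tr X.
  by rewrite mxtrace_mulC mulmxA mulmxV // mul1mx.
have tr_t t : \tr ((B + t *: E) ^+ 2) = \tr (B ^+ 2) + 2 * t.
  have EE : E *m E = 0.
    rewrite /E -!mulmxA (mulmxA Q) mulmxV // mul1mx (mulmxA (delta_mx _ _)).
    by rewrite mul_delta_mx_0 ?mul0mx ?mulmx0 // -val_eqE /= i2E; lia.
  have trEB : \tr (E *m B) = 1.
    rewrite BE /E -!mulmxA (mulmxA Q) mulmxV // mul1mx (mulmxA (delta_mx _ _)) (dC _ _ ord_max) ?i2E // mulmxA trE.
    rewrite /mxtrace (bigD1 ord_max) //= mxE !eqxx big1 ?addr0 // => k /negPf nk.
    by rewrite mxE nk.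
  rewrite !expr2 -!mulmxE mulmxDl !mulmxDr -!scalemxAl -!scalemxAr EE !scaler0 addr0.
  rewrite !mxtraceD !mxtraceZ (mxtrace_mulC B E) trEB; ring.
(* B + tE is B multiplied by a transvection; it needs an index [i3] two below the last one, so size
   at least 3. *)
have det_t t : \det (B + t *: E) = \det B.
  have -> : B + t *: E = (1%:M + t *: (invmx Q *m delta_mx ord_max i3 *m Q)) *m B.
    rewrite mulmxDl mul1mx -scalemxAl; congr (_ + _ *: _).
    rewrite /E BE -!mulmxA (mulmxA Q) mulmxV // mul1mx.
    by rewrite (mulmxA (delta_mx _ _)) (dC _ _ i2) // i2E i3E.
  rewrite det_mulmx [X in X * _](_ : _ = 1) ?mul1r //.
  have -> : 1%:M + t *: (invmx Q *m delta_mx ord_max i3 *m Q) =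
      invmx Q *m (1%:M + t *: delta_mx ord_max i3) *m Q.
    by rewrite mulmxDr mulmxDl mulmx1 mulVmx // -scalemxAr -scalemxAl.
  rewrite !det_mulmx mulrAC -det_mulmx mulVmx // det1 mul1r det_trig.
    apply: big1 => i _; rewrite !mxE eqxx; case: eqP => [->|_]; last by rewrite mulr0 addr0.
    by rewrite -val_eqE /= i3E (_ : _ == _ = false) ?mulr0 ?addr0 //; lia.
  apply/is_trig_mxP => i j ij; rewrite !mxE (_ : i == j = false); last first.
    by apply/eqP => e; rewrite e ltnn in ij.
  rewrite add0r (_ : _ && _ = false) ?mulr0 //; apply/negbTE; apply/andP => -[/eqP ei _].
  by have := ltn_ord j; move: ij; rewrite ei /=; lia.
(* If every square had one eigenvalue, the t making its trace 0 would give a nilpotent square, so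
   [\det B = 0]; the t making its trace 1 would then give a singular square with one nonzero
   eigenvalue. *)
apply: contrapT => nex.
have uni t : unispectral ((B + t *: E) ^+ 2).
  by apply: contrapT => nu; apply: nex; exists t.
have sqr_unit (X : 'M[K]_n.+3) : (X ^+ 2 \in unitmx) = (\det X != 0).
  by rewrite unitmxE expr2 det_mulmx unitfE mulf_eq0 orbb.
pose T0 := \tr (B ^+ 2).
have two0 : (2 : K) != 0 by rewrite pnatr_eq0.
have det0 : \det B = 0.
  have := unispectral_tr0 (uni (- T0 / 2)); rewrite tr_t mulrCA divff // mulr1 subrr.
  move/(_ erefl) => nil; apply/eqP; rewrite -(det_t (- T0 / 2)) -[_ == 0]negbK -sqr_unit.
  apply/negP => u; have := unitrX n.+3 u; rewrite nil unitr0 //.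
have := unispectral_singular (uni ((1 - T0) / 2)).
rewrite sqr_unit det_t det0 eqxx tr_t mulrCA divff // mulr1 addrC subrK.
by move/(_ isT)/eqP; rewrite oner_eq0.
Qed.

Lemma dense_nonunispectral n (A B : 'M[K]_n.+3) : Zn K _ (A, B) ->
  horner_mx (- B) (mxminpoly B) = 0 -> zclosure (@nonunispectral _) (A, B).
Proof.
move=> AB PN; have [uB|nuB] := pselect (unispectral (B ^+ 2)); last first.
  by apply: sub_zclosure; split=> //; right.
have [mu Bmu] := unispectral_sqrt uB.
have [d [Q [R [v [/andP[d0 dn] rowQ QR SB]]]]] := krylov_pair Bmu PN.
have ZS : Zn K _ (R *m Q, B) by rewrite /Zn /= addrC.
have [dlt|dge] := ltnP d n.+3.
  by apply: nonunispectral_line AB ZS _; apply: krylov_deficient => //; rewrite d0.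
have dE : d = n.+3 by apply/eqP; rewrite eqn_leq dn.
subst d; have [uQ SS] := krylov_cyclic QR.
have [q AE] := cyclic_anticomm rowQ uQ SS AB ZS.
have [t1 nu] := cyclic_perturb rowQ uQ.
set E := invmx Q *m _ *m Q in nu.
(* In the Krylov basis S is [alt_sign], with opposite signs at the two adjacent indices that E
   joins. *)
have SE : R *m Q *m E + E *m (R *m Q) = 0.
  have RE : R = invmx Q *m alt_sign K n.+3.
    by apply: (can_inj (mulKmx uQ)); rewrite mulKVmx.
  rewrite RE /E !mulmxA !mulmxK // -!mulmxA -mulmxDr !mulmxA -mulmxDl.
  rewrite (_ : alt_sign K _ *m _ + _ = 0) ?mul0mx ?mulmx0 //.
  apply/matrixP=> i j; rewrite mxE mul_diag_mx mul_mx_diag !mxE.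
  case: eqP => [->|_] /=; last by rewrite mulr0 mul0r addr0.
  case: eqP => [->|_] /=; last by rewrite mulr0 mul0r addr0.
  by rewrite inordK // exprS mulN1r mulr1 mul1r addNr.
pose Bt t := B + t *: E.
have -> : (A, B) = (R *m Q *m horner_mx (Bt 0) q, Bt 0).
  by rewrite /Bt scale0r addr0 -AE.
have UA := upoly_falg K.
have UB : mxfalg (@upoly K) Bt.
  apply: mxfalgD => //; first exact: mxfalgC.
  by apply: mxfalgZ => //; [apply: upoly_id | apply: mxfalgC].
apply: (@nonunispectral_curve _ (fun t => (R *m Q *m horner_mx (Bt t) q, Bt t)) 0 t1) => //.
- by apply: mxfalgM => //; [apply: mxfalgC | apply: mxfalg_horner].
- move=> t; apply: anticomm_horner; rewrite /Zn /= mulmxDr mulmxDl addrACA.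
  by rewrite -scalemxAr -scalemxAl -scalerDr SE scaler0 addr0.
- by right.
Qed.

Section Induction.
Variable n : nat.
Hypothesis IHn : forall k (y : mxpair K k), (k < n.+1)%N -> Zn K k y ->
  zclosure (@simple_diag K k) y.

Lemma nonunispectral_simple_diag (y : mxpair K n.+1) :
  nonunispectral y -> zclosure (@simple_diag K _) y.
Proof.
case=> Zy nu.
have c1 : comm_mx (y.1 ^+ 2) y.2 by apply: anticomm_sqr_comm.
have c2 : comm_mx (y.2 ^+ 2) y.1 by apply: anticomm_sqr_comm; rewrite addrC.
have cc (M : 'M[K]_n.+1) : comm_mx (M ^+ 2) M.
  by rewrite /comm_mx -[_ *m M]exprSr -[M *m _]exprS.
by case: nu; [apply: (zclosure_split IHn) | apply: (zclosure_split IHn)].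
Qed.

Lemma zclosure_nonunispectral (y : mxpair K n.+1) :
  zclosure (@nonunispectral n) y -> zclosure (@simple_diag K _) y.
Proof. by apply: zclosure_sub => z; apply: nonunispectral_simple_diag. Qed.

End Induction.

End Density.

(** * Density *)

Section Irreducibles.
Variable K : numClosedFieldType.

Definition disc2 (A : 'M[K]_2) := \tr A ^+ 2 - 4%:R * \det A.

Lemma simple_diag_disc2 (A B : 'M[K]_2) : Zn K _ (A, B) -> disc2 A != 0 ->
  simple_diag (A, B).
Proof.
move=> AB dA; split=> //.
have sc := size_char_poly A; have mc := char_poly_monic A.
have [rs rsE] := closed_field_poly_normal (char_poly A).
rewrite (monicP mc) scale1r in rsE.
have : size rs = 2 by move: sc; rewrite rsE size_prod_XsubC => -[].
case: rs rsE => [|a [|b []]] // rsE _.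
have trA : \tr A = a + b.
  apply: oppr_inj; rewrite -char_poly_trace // rsE big_cons big_seq1 coefM !big_ord_recl big_ord0.
  by rewrite /= !coefB !coefX !coefC /=; ring.
have detA : \det A = a * b.
  have := char_poly_det A; rewrite sqrrN expr1n mul1r rsE big_cons big_seq1 => <-.
  by rewrite coef0M !coefB !coefX !coefC /=; ring.
have ab : a != b.
  apply: contraNneq dA => ab; rewrite /disc2 trA detA ab; apply/eqP; ring.
have [P uP /similar_diagPex[d]] : exists2 P : 'M[K]_2, P \in unitmx & similar_diag P A.
  apply/diagonalizableP; exists [:: a; b]; first by rewrite /= inE ab.
  by rewrite -rsE; apply: mxminpoly_dvd_char.
move/(similarP uP) => PA.
have AE : A = invmx P *m diag_mx d *m P by rewrite -mulmxA -PA mulKmx.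
exists (invmx P), d; split; [by rewrite unitmx_inv | | by rewrite invmxK].
have dd : d 0 0 != d 0 1.
  apply: contraNneq dA => dd; rewrite /disc2 AE mxtrace_mulC mulmxA mulmxV // mul1mx.
  rewrite !det_mulmx mulrAC -det_mulmx mulVmx // det1 mul1r mxtrace_diag det_diag.
  rewrite !big_ord_recl !big_ord0 (_ : lift ord0 ord0 = 1) ?dd; last exact: val_inj.
  by apply/eqP; ring.
have E0 (k : 'I_2) : k = 0 \/ k = 1.
  by case: k => -[|[|]] // ?; [left | right]; apply: val_inj.
by move=> i j _; case: (E0 i) => ->; case: (E0 j) => -> // e; rewrite e eqxx in dd.
Qed.

(** In the cyclic case S has trace 0 and determinant -1, hence distinct eigenvalues, and so does a
    generic point of the line from A to S. *)
Lemma dense_simple_diag2 (A B : 'M[K]_2) :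
  (forall k (y : mxpair K k), (k < 2)%N -> Zn K k y -> zclosure (@simple_diag K k) y) ->
  Zn K _ (A, B) -> horner_mx (- B) (mxminpoly B) = 0 -> zclosure (@simple_diag K 2) (A, B).
Proof.
move=> IH AB PN; have [uB|nuB] := pselect (unispectral (B ^+ 2)); last first.
  by apply: nonunispectral_simple_diag => //; split=> //; right.
have [mu Bmu] := unispectral_sqrt uB.
have [d [Q [R [v [/andP[d0 dn] rowQ QR SB]]]]] := krylov_pair Bmu PN.
have ZS : Zn K _ (R *m Q, B) by rewrite /Zn /= addrC.
have [dlt|dge] := ltnP d 2.
  apply: zclosure_nonunispectral => //.
  by apply: nonunispectral_line AB ZS _; apply: krylov_deficient => //; rewrite d0.
have dE : d = 2 by apply/eqP; rewrite eqn_leq dn.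
subst d; have dS : disc2 (R *m Q) != 0.
  rewrite /disc2 mxtrace_mulC det_mulmx [\det R * _]mulrC -det_mulmx QR mxtrace_diag det_diag.
  rewrite !big_ord_recl !big_ord0 !mxE /= /bump /=.
  by rewrite !(expr0, expr1, mulr1, mul1r, addr0) subrr expr0n sub0r mulrN1 opprK pnatr_eq0.
have UA := upoly_falg K; have UL := upoly_line A (R *m Q).
have -> : (A, B) = ((1 - 0) *: A + 0 *: (R *m Q), B) :> mxpair K 2.
  by rewrite subr0 scale1r scale0r addr0.
apply: (@zclosure_curve K 2 _ (fun t => ((1 - t) *: A + t *: (R *m Q), B))
  (fun t => disc2 ((1 - t) *: A + t *: (R *m Q))) 0 1) => //.
- exact: (mxfalgC UA).
- apply: falgB => //; first by apply: falgX => //; apply: falg_tr.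
  by apply: falgM => //; [apply: falgC | apply: falg_det].
- by rewrite subrr scale0r add0r scale1r.
- by move=> t dt; apply: simple_diag_disc2 => //; apply: Zn_line.
Qed.

Lemma minpoly_opp_nilpotent n (B : 'M[K]_n.+1) k : B ^+ k = 0 ->
  horner_mx (- B) (mxminpoly B) = 0.
Proof.
move=> Bk; have : mxminpoly B %| ('X - 0%:P) ^+ k.
  by apply: mxminpoly_min; rewrite subr0 rmorphXn /= horner_mx_X.
case/dvdp_exp_XsubCP=> j _; rewrite eqp_monic ?mxminpoly_monic ?monic_exp ?monicXsubC //.
rewrite subr0 => /eqP PE; have := mx_root_minpoly B.
rewrite PE !rmorphXn /= !horner_mx_X => Bj.
by rewrite -scaleN1r exprZn Bj scaler0.
Qed.

Lemma minpoly_opp_unit n (A B : 'M[K]_n.+1) : A \in unitmx -> Zn K _ (A, B) ->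
  horner_mx (- B) (mxminpoly B) = 0.
Proof.
rewrite /Zn /= => uA /eqP; rewrite addrC addr_eq0 => /eqP AB.
have -> : - B = A *m B *m invmx A by rewrite -[A *m B]opprK -AB mulNmx mulmxK.
by rewrite horner_mx_uconj // mx_root_minpoly mulmx0 mul0mx.
Qed.

Lemma zclosure_swap n (S T : pset K n) (x : mxpair K n) :
  (forall y, S y -> zclosure T (y.2, y.1)) -> zclosure S x -> zclosure T (x.2, x.1).
Proof.
move=> ST; move: x; apply: (zclosure_preim (G := fun y => (y.2, y.1))) => //.
  exact: polyfun_mx2.
exact: polyfun_mx1.
Qed.

Lemma Zn_swap n (A B : 'M[K]_n) : Zn K n (A, B) -> Zn K n (B, A).
Proof. by rewrite /Zn /= addrC. Qed.

(* For 2 x 2 matrices, Cayley-Hamilton for B and A *m B ^+ 2 = B ^+ 2 *m A force tr B = 0. *)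
Lemma anticomm2_tr0 (A B : 'M[K]_2) : Zn K _ (A, B) -> A != 0 -> B \in unitmx ->
  \tr B = 0 /\ B ^+ 2 = (- \det B)%:M.
Proof.
move=> AB A0 uB.
have CH : B ^+ 2 = \tr B *: B - (\det B)%:M.
  have c0 : (char_poly B)`_0 = \det B by rewrite char_poly_det sqrrN expr1n mul1r.
  have c1 : (char_poly B)`_1 = - \tr B by rewrite char_poly_trace.
  have c2 : (char_poly B)`_2 = 1.
    by have := monicP (char_poly_monic B); rewrite lead_coefE size_char_poly.
  have := Cayley_Hamilton B; rewrite horner_mx_coefs size_char_poly.
  rewrite !big_ord_recl big_ord0 /= /bump /= c0 c1 c2 addr0 expr0 expr1 scale1r scaleNr.
  move/eqP; rewrite addrA addr_eq0 => /eqP E; apply: oppr_inj; rewrite -E opprB.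
  by rewrite -scalemx1 addrC.
have trB : \tr B = 0.
  have cAB : A *m B ^+ 2 = B ^+ 2 *m A by apply/esym/anticomm_sqr_comm/Zn_swap.
  move: cAB; rewrite CH mulmxBr mulmxBl scalar_mxC => /addIr.
  move: AB; rewrite /Zn /= addrC => /eqP; rewrite addr_eq0 => /eqP AB.
  rewrite -scalemxAr -scalemxAl AB scalerN => /eqP.
  rewrite -addr_eq0 -mulr2n -scaler_nat scalerA scaler_eq0 mulf_eq0 pnatr_eq0 /=.
  case/orP=> /eqP // AB0; case/eqP: A0.
  by rewrite -[A](mulmxK uB) AB0 mul0mx.
by split=> //; rewrite CH trB scale0r sub0r -raddfN.
Qed.

(** Either the even polynomial X^2 + det B is minimal, or B is scalar; in the latter case trace 0
    contradicts invertibility. *)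
Lemma minpoly_opp2 (B : 'M[K]_2) : \tr B = 0 -> B ^+ 2 = (- \det B)%:M -> B \in unitmx ->
  horner_mx (- B) (mxminpoly B) = 0.
Proof.
move=> trB B2 uB; pose c : {poly K} := 'X^2 + (\det B)%:P.
have sc : size c = 3.
  by rewrite size_polyDl ?size_polyXn // size_polyC; case: eqP.
have mc : c \is monic.
  by rewrite monicE lead_coefE sc coefD coefXn coefC /= addr0.
have hc (X : 'M[K]_2) : horner_mx X c = X ^+ 2 + (\det B)%:M.
  by rewrite rmorphD rmorphXn /= horner_mx_X horner_mx_C.
have Pc : mxminpoly B %| c by apply: mxminpoly_min; rewrite hc B2 -raddfD addNr raddf0.
have [sP|sP] := eqVneq (size (mxminpoly B)) 3.
  have /eqP -> : mxminpoly B == c.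
    by rewrite -eqp_monic ?mxminpoly_monic // -dvdp_size_eqp // sc sP.
  by rewrite hc sqrrN B2 -raddfD addNr raddf0.
have : is_scalar_mx B.
  rewrite -mxminpoly_linear_is_scalar; have := dvdp_leq (monic_neq0 mc) Pc.
  by rewrite sc; move: sP; rewrite size_mxminpoly; lia.
case/is_scalar_mxP=> b Bb; move: trB uB; rewrite Bb mxtrace_scalar => /eqP.
rewrite mulrn_eq0 /= => /eqP->; rewrite (_ : 0%:M = 0) ?unitr0 //.
by apply/matrixP=> i j; rewrite !mxE mul0rn.
Qed.

Theorem Zn_sub_closure n (x : mxpair K n) : Zn K n x -> zclosure (@simple_diag K n) x.
Proof.
elim/ltn_ind: n x => -[|[|n]] IHn x Zx.
- apply: sub_zclosure; split=> //; exists 1%:M, 0; split; first exact: unitmx1.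
    by case.
  by apply/matrixP => -[].
- apply: sub_zclosure; split=> //; exists 1%:M, (\row_i x.1 i i).
  split; [exact: unitmx1 | by move=> i j _ _; rewrite !ord1 |].
  by rewrite mul1mx invmx1 mulmx1; apply/matrixP=> i j; rewrite !ord1 !mxE eqxx.
case: x Zx => A B AB.
have IH k (y : mxpair K k) : (k < n.+2)%N -> Zn K k y -> zclosure (@simple_diag K k) y.
  by move=> kn; apply: IHn.
have main (X Y : 'M[K]_n.+2) : Zn K _ (X, Y) -> horner_mx (- Y) (mxminpoly Y) = 0 ->
    zclosure (@simple_diag K _) (X, Y).
  case: n {IHn AB A B} IH X Y => [|n] IH X Y XY PN; first exact: dense_simple_diag2.
  by apply: zclosure_nonunispectral => //; apply: dense_nonunispectral.
case: (boolP (A \in unitmx)) => [uA|nuA]; first exact: main (minpoly_opp_unit uA AB).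
have [uniA|nuniA] := pselect (unispectral (A ^+ 2)); last first.
  by apply: nonunispectral_simple_diag => //; split=> //; left.
have nA2 : A ^+ 2 \notin unitmx by rewrite unitmxE expr2 det_mulmx unitrM -unitmxE andbb.
have nilA : A ^+ (2 * n.+2) = 0.
  by rewrite exprM; apply: unispectral_tr0 (unispectral_singular uniA nA2).
case: (posnP n) => [n0|n_gt0]; last first.
  (* From size 3 on, the nilpotent A takes the role of B, and the symmetry of [nonunispectral]
     undoes the exchange. *)
  case: n n_gt0 {IHn main} IH A B AB nuA uniA nA2 nilA => // n _ IH A B AB _ _ _ nilA.
  apply: (@zclosure_swap _ (@nonunispectral K n.+2) _ (B, A)).
    move=> [Y X] [YX nu]; apply: nonunispectral_simple_diag => //.
    by split; [exact: Zn_swap | rewrite or_comm].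
  by apply: dense_nonunispectral; [exact: Zn_swap | exact: minpoly_opp_nilpotent nilA].
(* In size 2 no exchange is available, so the parity of the minimal polynomial of B itself is
   obtained, by cases on B, unless A = 0 or B^2 already has two eigenvalues. *)
subst n; have [A0|A0] := eqVneq A 0.
  apply: sub_zclosure; split=> //; exists 1%:M, 0; split; first exact: unitmx1.
    by move=> i j; rewrite mxE eqxx.
  by rewrite /= A0 linear0 mulmx0 mul0mx.
case: (boolP (B \in unitmx)) => uB.
  have [trB B2] := anticomm2_tr0 AB A0 uB; apply: main => //.
  exact: minpoly_opp2.
have [uniB|nuniB] := pselect (unispectral (B ^+ 2)); last first.
  by apply: nonunispectral_simple_diag => //; split=> //; right.
have nB2 : B ^+ 2 \notin unitmx by rewrite unitmxE expr2 det_mulmx unitrM -unitmxE andbb.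
apply: main => //; apply: (@minpoly_opp_nilpotent _ _ (2 * 2)).
by rewrite exprM; apply: unispectral_tr0 (unispectral_singular uniB nB2).
Qed.

End Irreducibles.

(** * Irreducible components *)

Section Components.
Variables (K : numClosedFieldType) (n' : nat).
Local Notation n := n'.+1.
Local Notation I := ('I_n.+1 * 'I_n.+1 * 'I_n.+1)%type.
Implicit Types (t : I) (x : mxpair K n).

Definition triples : seq I := enum [pred t : I | (2 * t.1.1 + t.1.2 + t.2)%N == n].
Definition stratum_closure t : pset K n := Zpmr K n t.1.1 t.1.2 t.2.

Lemma triplesP p m r : (2 * p + m + r = n)%N ->
  exists2 t, t \in triples & [/\ t.1.1 = p :> nat, t.1.2 = m :> nat & t.2 = r :> nat].
Proof.
move=> e; have [pn [mn rn]] : [/\ p < n.+1, (m < n.+1)%N & (r < n.+1)%N]%N.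
  by split; lia.
by exists (Ordinal pn, Ordinal mn, Ordinal rn); rewrite // mem_enum inE /= e.
Qed.

Lemma triples_eq t : t \in triples -> (2 * t.1.1 + t.1.2 + t.2)%N = n.
Proof. by rewrite mem_enum inE => /eqP. Qed.

Lemma zclosed_Zn : zclosed (Zn K n).
Proof.
exists (fun f => exists i j, f = fun x => (x.1 *m x.2 + x.2 *m x.1) i j).
split=> [_ [i [j ->]]|x].
  have PA := polyfun_falg K n; have P1 := @polyfun_mx1 K n; have P2 := @polyfun_mx2 K n.
  by apply: mxfalgD => //; apply: mxfalgM.
split=> [Zx _ [i [j ->]]|H]; first by rewrite Zx mxE.
by apply/matrixP=> i j; rewrite [RHS]mxE; apply: (H (fun x => _)); exists i, j.
Qed.

Lemma Zpmr_sub_Zn p m r : psubset (Zpmr K n p m r) (Zn K n).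
Proof.
apply: zclosure_min zclosed_Zn _ => _ [_ [g [A0 [B0 [a [ug _ _ AB ->]]]]]].
by rewrite /Zn /= conj_anticomm // AB mulmx0 mul0mx.
Qed.

Lemma Zn_cover x : Zn K n x -> exists2 t, t \in triples & stratum_closure t x.
Proof.
move/Zn_sub_closure => clx.
apply: (zclosure_bigU (S := fun t => Zcirc K n t.1.1 t.1.2 t.2)).
apply: zclosure_mono clx => y /simple_diag_Zcirc[p [m [r Zy]]].
have [t tt [tp tm tr]] := triplesP Zy.1.
by exists t => //; rewrite tp tm tr.
Qed.

Lemma zirreducible_sub_stratum Z : zirreducible Z -> psubset Z (Zn K n) ->
  exists2 t, t \in triples & psubset Z (stratum_closure t).
Proof.
move=> irrZ ZZn; apply: zirreducible_bigU irrZ _ _ => [t|x /ZZn/Zn_cover //].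
exact: zclosed_closure.
Qed.

Lemma irr_component_Zpmr p m r : (2 * p + m + r = n)%N ->
  irr_component (Zn K n) (Zpmr K n p m r).
Proof.
move=> e; split; [exact: zirreducible_Zpmr e | exact: Zpmr_sub_Zn |].
move=> Z irrZ sub ZZn; have [t tt Zt] := zirreducible_sub_stratum irrZ ZZn.
have [ep em er] := Zpmr_sub_eq e (triples_eq tt) (fun x Zx => Zt x (sub x Zx)).
by move=> x /Zt; rewrite /stratum_closure -ep -em -er.
Qed.

Lemma irr_component_is_Zpmr Z : irr_component (Zn K n) Z ->
  exists p m r, (2 * p + m + r)%N = n /\ pseteq Z (Zpmr K n p m r).
Proof.
case=> irrZ ZZn maxZ; have [t tt Zt] := zirreducible_sub_stratum irrZ ZZn.
have e := triples_eq tt; exists t.1.1, t.1.2, t.2; split=> // x; split; first exact: Zt.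
by apply: maxZ => //; [exact: zirreducible_Zpmr e | exact: Zpmr_sub_Zn].
Qed.

End Components.

Theorem theorem5p6 (R : realType) (n : nat) (hn : (1 <= n)%N) :
  let C := R[i] in
  [/\ (* each Z_{p,m,r}, (p,m,r) in TP_n, is an irreducible component *)
      (forall p m r : nat, (2 * p + m + r)%N = n ->
         irr_component (Zn C n) (Zpmr C n p m r)),
      (* every irreducible component is one of them *)
      (forall Z : pset C n, irr_component (Zn C n) Z ->
         exists p m r : nat, (2 * p + m + r)%N = n /\ pseteq Z (Zpmr C n p m r)),
      (* distinct triples give distinct components *)
      (forall p m r p' m' r' : nat, (2 * p + m + r)%N = n ->
         (2 * p' + m' + r')%N = n ->
         pseteq (Zpmr C n p m r) (Zpmr C n p' m' r') ->
         [/\ p = p', m = m' & r = r']),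
      (* Z_n is the union of the Z_{p,m,r} *)
      (forall x : mxpair C n, Zn C n x <->
         exists p m r : nat, (2 * p + m + r)%N = n /\ Zpmr C n p m r x) &
      (* dimension *)
      (forall p m r : nat, (2 * p + m + r)%N = n ->
         zdim (Zpmr C n p m r) (n ^ 2 + p)%N)].
Proof.
case: n hn => // n _ C; split.
- exact: irr_component_Zpmr.
- exact: irr_component_is_Zpmr.
- by move=> p m r p' m' r' e e' E; apply: (Zpmr_sub_eq e e') => x /E.
- move=> x; split=> [/Zn_cover[t tt Zx]|[p [m [r [_]]]]]; last exact: Zpmr_sub_Zn.
  by exists t.1.1, t.1.2, t.2; split=> //; apply: triples_eq.
- by move=> p m r e; apply: zdim_Zpmr e.
Qed.
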